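(* Let $(E,\mathrm g)$ be a pseudo-Euclidean vector bundle of even rank over a smooth manifold $M$ admitting a spinor bundle $S$. The subspaces $\{\mathcal D_k(M,S)\}_{k\in\mathbb N}$ define an increasing and exhaustive filtration of the algebra $\mathcal D(M,S)$: $$\mathcal D_0(M,S)\subset\mathcal D_1(M,S)\subset\cdots\subset\mathcal D_k(M,S)\subset\cdots,\qquad \mathcal D(M,S)=\bigcup_{k\in\mathbb N}\mathcal D_k(M,S).$$ Moreover, for any $k,l\in\mathbb N$, $$\mathcal D_k(M,S)\cdot\mathcal D_l(M,S)\subseteq\mathcal D_{k+l}(M,S),\qquad[\mathcal D_k(M,S),\mathcal D_l(M,S)]\subseteq\mathcal D_{k+l-2}(M,S).$$
   Context: A pseudo-Euclidean vector bundle is a real vector bundle $E\to M$ with a nondegenerate symmetric fibre metric $\mathrm g$. The real Clifford bundle $\mathrm{Cl}(E)$ is generated by $E$ with relation $\xi\eta+\eta\xi=\mathrm g(\xi,\eta)$, and $\mathbb C\mathrm l(E)=\mathrm{Cl}(E)\otimes\mathbb C=\mathbb C\mathrm l^+(E)\oplus\mathbb C\mathrm l^-(E)$ (even/odd parts). A spinor bundle is a complex vector bundle $S\to M$ with an algebra bundle isomorphism $\operatorname{End}S\cong\mathbb C\mathrm l(E)$; $\gamma:\Gamma(E)\to\Gamma(\operatorname{End}S)$ denotes the Clifford action. A spinor connection on $S$ is a connection $\nabla^S$ for which there is a metric connection $\nabla^E$ on $E$ with $[\nabla^S_X,\gamma(\xi)]=\gamma(\nabla^E_X\xi)$ for all $X\in\mathfrak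 X(M)$, $\xi\in\Gamma(E)$. $\mathcal D(M,S)$ is the algebra of differential operators on $S$, with the $\mathbb Z_2$-grading in which spinor covariant derivatives $\nabla_X^S$ are even and $\Gamma(\mathbb C\mathrm l^{\pm}(E))$ are even/odd. $[A,B]=AB-(-1)^{|A||B|}BA$ is the graded commutator. $\mathcal D_{-1}(M,S):=\{0\}$ (and likewise $\mathcal D_{-2}(M,S)=\{0\}$) and, inductively for $k\ge0$, $$\mathcal D_k(M,S):=\{D\in\mathcal D(M,S)\mid[D,\gamma(\xi)]\in\mathcal D_{k-1}(M,S)\ \ \forall\xi\in\Gamma(E)\}.$$
   Formalization: The rank of E is assumed positive: for rank 0 the Clifford action vanishes, so D_0(M,S) = D(M,S) is noncommutative when dim M > 0 and [D_0, D_0] ⊆ D_{-2} = {0} fails. *)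

(* Defs.v *)
From HB Require Import structures.
From mathcomp Require Import all_boot all_order all_algebra.
From mathcomp Require Import boolp classical_sets functions cardinality reals.
From mathcomp Require Import topology normedtype derive.
From mathcomp Require Import complex.
Set Implicit Arguments.
Unset Strict Implicit.
Unset Printing Implicit Defensive.
Import Order.TTheory GRing.Theory Num.Theory.
Import numFieldNormedType.Exports.
Local Open Scope classical_set_scope.
Local Open Scope ring_scope.

Section Ck.
Variables (R : realType) (n : nat).
Implicit Types (U : set 'rV[R]_n) (f g : 'rV[R]_n -> R).

(* Only meaningful for U open. *)
Fixpoint Ck (k : nat) U f : Prop :=
  (forall y, U y -> {for y, continuous f}) /\
  if k is k'.+1 then forall i : 'I_n,
    (forall y, U y -> derivable f y (delta_mx ord0 i)) /\
    Ck k' U (fun y => 'D_(delta_mx ord0 i) f y)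
  else True.

Lemma Ck_cont k U f y : Ck k U f -> U y -> {for y, continuous f}.
Proof. by case: k => [|k] [+ _]; apply. Qed.

Lemma CkW k U f : Ck k.+1 U f -> Ck k U f.
Proof.
elim: k f => [|k IH] f; first by case.
move=> [cf df]; split=> // i; have [dfi Ci] := df i; split=> //.
exact: IH.
Qed.

Lemma Ck_ext k U f g : open U -> {in U, f =1 g} -> Ck k U f -> Ck k U g.
Proof.
move=> oU; elim: k f g => [|k IH] f g fg.
all: have nfg y : U y -> \forall z \near y, f z = g z.
1,3: move=> Uy; have : nbhs y U by exact: open_nbhs_nbhs.
1,2: by apply: filterS => z Uz; apply: fg; rewrite inE.
all: have cg : (forall y, U y -> {for y, continuous f}) ->
    forall y, U y -> {for y, continuous g}.
1,3: move=> cf y Uy; apply: cvg_trans (near_eq_cvg (nfg y Uy)) _.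
1,2: by rewrite -fg ?inE//; exact: cf.
- by move=> [/cg].
- move=> [/cg Cg df]; split=> // i; have [dfi Ci] := df i; split.
    by move=> y Uy; apply: near_eq_derivable (dfi _ Uy); exact: nfg.
  apply: IH Ci => y; rewrite inE => Uy.
  by apply: near_eq_derive; exact: nfg.
Qed.

Lemma Ck_cst k U (c : R) : Ck k U (cst c).
Proof.
elim: k c => [|k IH] c; split=> [y _|] //; try exact: cst_continuous.
move=> i; split=> [y _|]; first exact: derivable_cst.
have -> : (fun y => 'D_(delta_mx ord0 i) (cst c) y) = cst (0 : R) :> ('rV[R]_n -> R).
  by apply/funext => y; rewrite derive_cst.
exact: IH.
Qed.

Lemma CkD k U f g : open U -> Ck k U f -> Ck k U g -> Ck k U (f + g).
Proof.
move=> oU; elim: k f g => [|k IH] f g [cf df] [cg dg].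
all: split; first by
  move=> y Uy; apply: (@continuousD _ _ _ f g); [exact: cf|exact: cg].
- by [].
- move=> i; have [dfi Cf] := df i; have [dgi Cg] := dg i; split.
    by move=> y Uy; apply: derivableD; [exact: dfi|exact: dgi].
  apply: Ck_ext (IH _ _ Cf Cg) => // y; rewrite inE => Uy /=.
  by rewrite deriveD//; [exact: dfi|exact: dgi].
Qed.

Lemma CkM k U f g : open U -> Ck k U f -> Ck k U g -> Ck k U (f * g).
Proof.
move=> oU; elim: k f g => [|k IH] f g /[dup] Cf0 [cf df] /[dup] Cg0 [cg dg].
all: split; first by
  move=> y Uy; apply: (@continuousM _ _ f g); [exact: cf|exact: cg].
- by [].
- move=> i; have [dfi Cf] := df i; have [dgi Cg] := dg i; split.
    by move=> y Uy; apply: derivableM; [exact: dfi|exact: dgi].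
  apply: Ck_ext (CkD oU (IH _ _ (CkW Cf0) Cg) (IH _ _ (CkW Cg0) Cf)) => // y.
  by rewrite inE => Uy /=; rewrite deriveM//; [exact: dfi|exact: dgi].
Qed.

End Ck.

Record manifold (R : realType) := Manifold {
  carrier :> topologicalType;
  mdim : nat;
  mchart : Type;
  cdom : mchart -> set carrier;
  cmap : mchart -> carrier -> 'rV[R]_mdim;
  cinv : mchart -> 'rV[R]_mdim -> carrier;
  manifold_hausdorff : hausdorff_space carrier;
  manifold_second_countable : @second_countable carrier;
  cdom_cover : forall x, exists c, cdom c x;
  cdom_open : forall c, open (cdom c);
  cimg_open : forall c, open (cmap c @` cdom c);
  cmapK : forall c x, cdom c x -> cinv c (cmap c x) = x;
  cmap_continuous : forall c x, cdom c x -> {for x, continuous (cmap c)};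
  cinv_continuous : forall c y, (cmap c @` cdom c) y ->
    {for y, continuous (cinv c)};
  transition_smooth : forall c d (i : 'I_mdim) k,
    Ck k (cmap c @` (cdom c `&` cdom d))
      (fun y => cmap d (cinv c y) ord0 i) }.

Arguments cdom {R m}.
Arguments cmap {R m}.
Arguments cinv {R m}.

Section SmoothReal.
Variables (R : realType) (M : manifold R).
Implicit Types (W : set M) (f g : M -> R).

(* Only meaningful for W open. *)
Definition smooth_on W f : Prop :=
  forall (c : mchart M) k, Ck k (cmap c @` (cdom c `&` W)) (f \o cinv c).

Lemma cimgI_open (c : mchart M) W : open W -> open (cmap c @` (cdom c `&` W)).
Proof.
move=> oW; rewrite openE => _ [x [cx Wx] <-].
have ix : (cmap c @` cdom c) (cmap c x) by exists x.
have nW : nbhs (cinv c (cmap c x)) W.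
  by rewrite cmapK//; exact: open_nbhs_nbhs.
have := cinv_continuous ix nW.
have : nbhs (cmap c x) (cmap c @` cdom c).
  by apply: open_nbhs_nbhs; split => //; exact: cimg_open.
rewrite /interior /=; apply: filterS2 => _ [z cz <-] /=; rewrite cmapK// => Wz.
by exists z.
Qed.

Lemma smooth_on_cst W (a : R) : smooth_on W (cst a).
Proof. by move=> c k; exact: Ck_cst. Qed.

Lemma smooth_onD W f g : open W ->
  smooth_on W f -> smooth_on W g -> smooth_on W (f + g).
Proof. by move=> oW sf sg c k; apply: CkD => //; exact: cimgI_open. Qed.

Lemma smooth_onM W f g : open W ->
  smooth_on W f -> smooth_on W g -> smooth_on W (f * g).
Proof. by move=> oW sf sg c k; apply: CkM => //; exact: cimgI_open. Qed.

Lemma smooth_onN W f : open W -> smooth_on W f -> smooth_on W (- f).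
Proof.
move=> oW sf; have -> : - f = cst (-1) * f.
  by apply/funext => x; apply/esym; exact: mulN1r.
by apply: smooth_onM => //; exact: smooth_on_cst.
Qed.

Lemma smooth_on_sub W W' f : open W -> W `<=` W' ->
  smooth_on W' f -> smooth_on W f.
Proof.
move=> oW WW' sf c k; have : Ck k (cmap c @` (cdom c `&` W')) (f \o cinv c).
  exact: sf.
have sub : cmap c @` (cdom c `&` W) `<=` cmap c @` (cdom c `&` W').
  by move=> _ [x [cx /WW' Wx] <-]; exists x.
elim: k (f \o cinv c) => [|k IH] h [ch dh]; (split; first by move=> y /sub /ch).
  by [].
move=> i; have [di Ci] := dh i; split; first by move=> y /sub /di.
exact: IH.
Qed.

End SmoothReal.

(* Packages R and R[i] uniformly, so that real and complex vector bundles are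
   instances of one definition. *)
Record scalars (R : realType) := Scalars {
  scalar_field :> fieldType;
  of_real : {rmorphism R -> scalar_field};
  to_complex : {rmorphism scalar_field -> R[i]};
  to_complexK : forall a, to_complex (of_real a) = a%:C%C }.

Arguments of_real {R s}.
Arguments to_complex {R s}.

Definition real_scalars (R : realType) : scalars R :=
  @Scalars R R idfun (real_complex R) (fun=> erefl).
Definition complex_scalars (R : realType) : scalars R :=
  @Scalars R R[i] (real_complex R) idfun (fun=> erefl).

Section SmoothScalar.
Variables (R : realType) (M : manifold R) (K : scalars R).
Implicit Types (W : set M) (f g : M -> K).

Let ReM (z w : R[i]) : complex.Re (z * w) =
  complex.Re z * complex.Re w - complex.Im z * complex.Im w.
Proof. by case: z w => [a b] [c d]. Qed.

Let ImM (z w : R[i]) : complex.Im (z * w) =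
  complex.Re z * complex.Im w + complex.Im z * complex.Re w.
Proof. by case: z w => [a b] [c d]. Qed.

Definition smooth W f : Prop :=
  smooth_on W (fun x => complex.Re (to_complex (f x))) /\
  smooth_on W (fun x => complex.Im (to_complex (f x))).

Lemma smooth_cst W (a : K) : smooth W (cst a).
Proof.
split; first exact: (smooth_on_cst W (complex.Re (to_complex a))).
exact: (smooth_on_cst W (complex.Im (to_complex a))).
Qed.

Lemma smoothD W f g : open W -> smooth W f -> smooth W g -> smooth W (f + g).
Proof.
move=> oW [f1 f2] [g1 g2]; split.
  rewrite (_ : (fun _ => _) = (fun x => complex.Re (to_complex (f x))) +
    (fun x => complex.Re (to_complex (g x)))); first exact: smooth_onD.
  by apply/funext => x /=; rewrite rmorphD raddfD.
rewrite (_ : (fun _ => _) = (fun x => complex.Im (to_complex (f x))) +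
  (fun x => complex.Im (to_complex (g x)))); first exact: smooth_onD.
by apply/funext => x /=; rewrite rmorphD raddfD.
Qed.

Lemma smoothM W f g : open W -> smooth W f -> smooth W g -> smooth W (f * g).
Proof.
move=> oW [f1 f2] [g1 g2]; split.
  rewrite (_ : (fun _ => _) =
    (fun x => complex.Re (to_complex (f x))) *
      (fun x => complex.Re (to_complex (g x))) +
    - ((fun x => complex.Im (to_complex (f x))) *
      (fun x => complex.Im (to_complex (g x))))).
    by apply: smooth_onD => //; [|apply: smooth_onN => //]; exact: smooth_onM.
  apply/funext => x; rewrite [in LHS]rmorphM; exact: ReM.
rewrite (_ : (fun _ => _) =
  (fun x => complex.Re (to_complex (f x))) *
    (fun x => complex.Im (to_complex (g x))) +
  (fun x => complex.Im (to_complex (f x))) *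
    (fun x => complex.Re (to_complex (g x)))).
  by apply: smooth_onD => //; exact: smooth_onM.
apply/funext => x; rewrite [in LHS]rmorphM; exact: ImM.
Qed.

Lemma smoothN W f : open W -> smooth W f -> smooth W (- f).
Proof.
move=> oW sf; have -> : - f = cst (-1) * f.
  by apply/funext => x; apply/esym; exact: mulN1r.
by apply: smoothM => //; exact: smooth_cst.
Qed.

Lemma smooth_sub W W' f : open W -> W `<=` W' -> smooth W' f -> smooth W f.
Proof. by move=> oW s [f1 f2]; split; apply: smooth_on_sub s _. Qed.

Definition smooth_pred : {pred M -> K} := fun f => `[< smooth setT f >].

Fact smooth_subring_closed : subring_closed smooth_pred.
Proof.
split=> [|f g|f g]; first exact/asboolP/smooth_cst.
- move=> /asboolP sf /asboolP sg; apply/asboolP.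
  by apply: smoothD; [exact: openT| |apply: smoothN => //; exact: openT].
- move=> /asboolP sf /asboolP sg; apply/asboolP.
  by apply: smoothM; [exact: openT| |].
Qed.

(* The algebra of smooth K-valued functions on M; it is the zero ring when M is
   empty, whence pzRingType. *)
Record smoothf := Smoothf { smoothf_fun :> M -> K; _ : smoothf_fun \in smooth_pred }.
HB.instance Definition _ := [isSub for smoothf_fun].
HB.instance Definition _ := [Choice of smoothf by <:].
HB.instance Definition _ := GRing.SubChoice_isSubComPzRing.Build (M -> K) smooth_pred
  smoothf smooth_subring_closed.

Lemma smoothfP (f : smoothf) : smooth setT f.
Proof. by case: f => f h; exact/asboolP. Qed.

Definition mk_smoothf (f : M -> K) (sf : smooth setT f) : smoothf :=
  Smoothf (introT (asboolP _) sf).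

Definition smoothf_cst (a : K) : smoothf := mk_smoothf (smooth_cst setT a).

End SmoothScalar.

Arguments smoothf {R} M K.

Notation "C^oo( M )" := (smoothf M (real_scalars _)) (format "C^oo( M )").

Section RealPart.
Variables (R : realType) (M : manifold R) (K : scalars R).

Lemma smooth_of_real (f : C^oo(M)) :
  smooth setT (fun x => of_real (f x) : K).
Proof.
have [s1 s2] := smoothfP f; split.
- by rewrite (_ : (fun _ => _) = fun x => complex.Re (to_complex (f x)));
    [|apply/funext => x; rewrite to_complexK].
- by rewrite (_ : (fun _ => _) = fun x => complex.Im (to_complex (f x)));
    [|apply/funext => x; rewrite to_complexK].
Qed.

Definition smoothf_of_real (f : C^oo(M)) : smoothf M K :=
  mk_smoothf (smooth_of_real f).

End RealPart.

Arguments smoothf_of_real {R M K}.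

(* A bundle is presented by its fibres and local trivializations whose
   transition matrices are smooth (acting on row vectors, hence on the right). *)
Record vbundle (R : realType) (M : manifold R) (K : scalars R) := VBundle {
  fibre :> M -> vectType K;
  vrank : nat;
  vtriv : Type;
  tdom : vtriv -> set M;
  tmap : vtriv -> forall x, {linear fibre x -> 'rV[K]_vrank};
  tdom_open : forall a, open (tdom a);
  tdom_cover : forall x, exists a, tdom a x;
  tmap_bij : forall a x, tdom a x -> bijective (tmap a x);
  transition_matrix : forall a b, exists T : M -> 'M[K]_vrank,
    (forall i j, smooth (tdom a `&` tdom b) (fun x => T x i j : K)) /\
    (forall x, tdom a x -> tdom b x ->
       forall v, tmap b x v = tmap a x v *m T x) }.

Arguments tdom {R M K v}.
Arguments tmap {R M K v}.

Notation real_bundle M := (vbundle M (real_scalars _)).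
Notation complex_bundle M := (vbundle M (complex_scalars _)).

Section Sections.
Variables (R : realType) (M : manifold R) (K : scalars R) (E : vbundle M K).
Implicit Types (W : set M) (s t : forall x, E x).

Definition smooth_section W s : Prop :=
  forall (a : vtriv E) (i : 'I_(vrank E)),
    smooth (tdom a `&` W) (fun x => tmap a x (s x) ord0 i : K).

Lemma smooth_section0 : smooth_section setT (fun x => 0 : E x).
Proof.
move=> a i; rewrite (_ : (fun _ => _) = cst (0 : K)); first exact: smooth_cst.
by apply/funext => x; rewrite linear0 mxE.
Qed.

Lemma smooth_sectionD s t : smooth_section setT s -> smooth_section setT t ->
  smooth_section setT (fun x => s x + t x).
Proof.
move=> hs ht a i.
rewrite (_ : (fun _ => _) = (fun x => tmap a x (s x) ord0 i : K) +
  (fun x => tmap a x (t x) ord0 i : K)).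
  apply: smoothD; [|exact: hs|exact: ht].
  by apply: openI; [exact: tdom_open|exact: openT].
by apply/funext => x; rewrite linearD mxE.
Qed.

Lemma smooth_sectionZ (f : smoothf M K) s : smooth_section setT s ->
  smooth_section setT (fun x => f x *: s x).
Proof.
move=> hs a i.
rewrite (_ : (fun _ => _) = (f : M -> K) * (fun x => tmap a x (s x) ord0 i : K)).
  have o : open (tdom a `&` setT).
    by apply: openI; [exact: tdom_open|exact: openT].
  apply: smoothM => //; apply: (smooth_sub _ _ (smoothfP f)) => //.
by apply/funext => x; rewrite linearZ mxE.
Qed.

Lemma smooth_sectionN s : smooth_section setT s ->
  smooth_section setT (fun x => - s x).
Proof.
move=> hs; rewrite (_ : (fun x => - s x) =
    (fun x => smoothf_cst M (-1 : K) x *: s x)); first exact: smooth_sectionZ.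
by apply: functional_extensionality_dep => x; rewrite /= scaleN1r.
Qed.

Record section := Section { section_fun :> forall x, E x;
  sectionP : smooth_section setT section_fun }.

Lemma section_eq (s t : section) : (forall x, s x = t x) -> s = t.
Proof.
case: s t => [s hs] [t ht] /= st.
have {}st : s = t by apply: functional_extensionality_dep.
by subst t; congr Section; exact: Prop_irrelevance.
Qed.

HB.instance Definition _ := gen_eqMixin section.
HB.instance Definition _ := gen_choiceMixin section.

Definition section_zero := Section smooth_section0.
Definition section_add (s t : section) :=
  Section (smooth_sectionD (sectionP s) (sectionP t)).
Definition section_opp (s : section) := Section (smooth_sectionN (sectionP s)).
Definition section_scale (f : smoothf M K) (s : section) :=
  Section (smooth_sectionZ f (sectionP s)).

Fact section_addA : associative section_add.
Proof. by move=> s t u; apply: section_eq => x /=; rewrite addrA. Qed.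
Fact section_addC : commutative section_add.
Proof. by move=> s t; apply: section_eq => x /=; rewrite addrC. Qed.
Fact section_add0 : left_id section_zero section_add.
Proof. by move=> s; apply: section_eq => x /=; rewrite add0r. Qed.
Fact section_addN : left_inverse section_zero section_opp section_add.
Proof. by move=> s; apply: section_eq => x /=; rewrite addNr. Qed.

HB.instance Definition _ := GRing.isZmodule.Build section
  section_addA section_addC section_add0 section_addN.

Fact section_scaleA f g (s : section) :
  section_scale f (section_scale g s) = section_scale (f * g) s.
Proof. by apply: section_eq => x /=; rewrite scalerA. Qed.
Fact section_scale1 : left_id 1 section_scale.
Proof. by move=> s; apply: section_eq => x /=; rewrite scale1r. Qed.
Fact section_scaleDr : right_distributive section_scale +%R.
Proof. by move=> f s t; apply: section_eq => x /=; rewrite scalerDr. Qed.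
Fact section_scaleDl (s : section) : {morph section_scale^~ s : f g / f + g}.
Proof. by move=> f g; apply: section_eq => x /=; rewrite scalerDl. Qed.

HB.instance Definition _ := GRing.Zmodule_isLmodule.Build (smoothf M K) section
  section_scaleA section_scale1 section_scaleDr section_scaleDl.

End Sections.

Notation "'Gamma(' E )" := (section E) (format "'Gamma(' E )").

Record fibre_metric (R : realType) (M : manifold R) (E : real_bundle M) :=
  FibreMetric {
  metric :> forall x, E x -> E x -> R;
  metric_linear : forall x (a : R) (u v w : E x),
    metric (a *: u + v) w = a * metric u w + metric v w;
  metric_sym : forall x (u v : E x), metric u v = metric v u;
  metric_nondegenerate : forall x (u : E x),
    (forall v, metric u v = 0) -> u = 0;
  metric_smooth : forall (W : set M) (s t : forall x, E x), open W ->
    smooth_section W s -> smooth_section W t ->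
    smooth W (fun x => metric (s x) (t x) : real_scalars R) }.

Definition metric_section (R : realType) (M : manifold R) (E : real_bundle M)
    (g : fibre_metric E) (s t : Gamma(E)) : C^oo(M) :=
  mk_smoothf (metric_smooth g openT (sectionP s) (sectionP t)).

Section Clifford.
Variables (R : realType) (V : lmodType R) (b : V -> V -> R).

Inductive cl_term : Type :=
| CGen of V
| CCst of R[i]
| CAdd of cl_term & cl_term
| CMul of cl_term & cl_term.

Local Notation "x +c y" := (CAdd x y) (at level 50, left associativity).
Local Notation "x *c y" := (CMul x y) (at level 40, left associativity).

(* The least congruence making the terms a unital associative complex algebra
   in which CGen is real-linear and satisfies the Clifford relation; thus the
   quotient is Cl(V, b) tensored with the complex numbers. *)
Inductive cl_eq : cl_term -> cl_term -> Prop :=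
| cl_refl x : cl_eq x x
| cl_sym x y : cl_eq x y -> cl_eq y x
| cl_trans x y z : cl_eq x y -> cl_eq y z -> cl_eq x z
| cl_add x x' y y' : cl_eq x x' -> cl_eq y y' -> cl_eq (x +c y) (x' +c y')
| cl_mul x x' y y' : cl_eq x x' -> cl_eq y y' -> cl_eq (x *c y) (x' *c y')
| cl_addA x y z : cl_eq (x +c (y +c z)) ((x +c y) +c z)
| cl_addC x y : cl_eq (x +c y) (y +c x)
| cl_add0 x : cl_eq (CCst 0 +c x) x
| cl_addN x : cl_eq ((CCst (-1) *c x) +c x) (CCst 0)
| cl_mulA x y z : cl_eq (x *c (y *c z)) ((x *c y) *c z)
| cl_mul1 x : cl_eq (CCst 1 *c x) x
| cl_mulDl x y z : cl_eq ((x +c y) *c z) ((x *c z) +c (y *c z))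
| cl_mulDr x y z : cl_eq (x *c (y +c z)) ((x *c y) +c (x *c z))
| cl_cstD c d : cl_eq (CCst (c + d)) (CCst c +c CCst d)
| cl_cstM c d : cl_eq (CCst (c * d)) (CCst c *c CCst d)
| cl_cstC c x : cl_eq (CCst c *c x) (x *c CCst c)
| cl_gen_linear a u v :
    cl_eq (CGen (a *: u + v)) ((CCst a%:C%C *c CGen u) +c CGen v)
| cl_clifford u v :
    cl_eq ((CGen u *c CGen v) +c (CGen v *c CGen u)) (CCst (b u v)%:C%C).

HB.instance Definition _ := gen_eqMixin cl_term.
HB.instance Definition _ := gen_choiceMixin cl_term.

Definition cl_eqb (x y : cl_term) : bool := `[< cl_eq x y >].

Fact cl_eqb_equiv : equiv_class_of cl_eqb.
Proof.
split=> [x|x y|y x z]; first exact/asboolP/cl_refl.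
- by apply/asboolP/asboolP; exact: cl_sym.
- by move=> /asboolP xy /asboolP yz; apply/asboolP; exact: cl_trans xy yz.
Qed.

Canonical cl_equiv := EquivRelPack cl_eqb_equiv.

Local Open Scope quotient_scope.

Definition clifford := {eq_quot cl_equiv}.
HB.instance Definition _ := Choice.on clifford.
HB.instance Definition _ := EqQuotient.on clifford.

Definition clpi (x : cl_term) : clifford := \pi x.

Fact clpiE x y : cl_eq x y -> clpi x = clpi y.
Proof. by move=> xy; apply/eqmodP; exact/asboolP. Qed.

Fact clpi_repr x : cl_eq (repr (clpi x)) x.
Proof. by apply/asboolP; apply/(@eqmodP _ cl_equiv); rewrite reprK. Qed.

Fact clifford_ind (P : clifford -> Prop) :
  (forall x, P (clpi x)) -> forall x, P x.
Proof. by move=> Px x; rewrite -[x]reprK; exact: Px. Qed.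

Definition cl_cst (c : R[i]) : clifford := clpi (CCst c).
Definition cl_gen (v : V) : clifford := clpi (CGen v).
Definition clifford_add (x y : clifford) : clifford := clpi (repr x +c repr y).
Definition clifford_mul (x y : clifford) : clifford := clpi (repr x *c repr y).
Definition clifford_opp (x : clifford) : clifford :=
  clifford_mul (cl_cst (-1)) x.

Fact clpiD x y : clpi (x +c y) = clifford_add (clpi x) (clpi y).
Proof. by apply: clpiE; apply: cl_add; apply: cl_sym; exact: clpi_repr. Qed.

Fact clpiM x y : clpi (x *c y) = clifford_mul (clpi x) (clpi y).
Proof. by apply: clpiE; apply: cl_mul; apply: cl_sym; exact: clpi_repr. Qed.

Fact clifford_addA : associative clifford_add.
Proof.
elim/clifford_ind=> x; elim/clifford_ind=> y; elim/clifford_ind=> z.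
by rewrite -!clpiD; apply: clpiE; exact: cl_addA.
Qed.

Fact clifford_addC : commutative clifford_add.
Proof.
elim/clifford_ind=> x; elim/clifford_ind=> y.
by rewrite -!clpiD; apply: clpiE; exact: cl_addC.
Qed.

Fact clifford_add0 : left_id (cl_cst 0) clifford_add.
Proof.
by elim/clifford_ind=> x; rewrite -clpiD; apply: clpiE; exact: cl_add0.
Qed.

Fact clifford_addN : left_inverse (cl_cst 0) clifford_opp clifford_add.
Proof.
elim/clifford_ind=> x; rewrite /clifford_opp -clpiM -clpiD.
by apply: clpiE; exact: cl_addN.
Qed.

HB.instance Definition _ := GRing.isZmodule.Build clifford
  clifford_addA clifford_addC clifford_add0 clifford_addN.

Fact clifford_mulA : associative clifford_mul.
Proof.
elim/clifford_ind=> x; elim/clifford_ind=> y; elim/clifford_ind=> z.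
by rewrite -!clpiM; apply: clpiE; exact: cl_mulA.
Qed.

Fact clifford_mul1 : left_id (cl_cst 1) clifford_mul.
Proof.
by elim/clifford_ind=> x; rewrite -clpiM; apply: clpiE; exact: cl_mul1.
Qed.

Fact clifford_cstC c x :
  clifford_mul (cl_cst c) x = clifford_mul x (cl_cst c).
Proof.
by elim/clifford_ind: x => x; rewrite -!clpiM; apply: clpiE; exact: cl_cstC.
Qed.

Fact clifford_mulr1 : right_id (cl_cst 1) clifford_mul.
Proof. by move=> x; rewrite -clifford_cstC clifford_mul1. Qed.

Fact clifford_mulDl : left_distributive clifford_mul clifford_add.
Proof.
elim/clifford_ind=> x; elim/clifford_ind=> y; elim/clifford_ind=> z.
by rewrite -clpiD -!clpiM -clpiD; apply: clpiE; exact: cl_mulDl.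
Qed.

Fact clifford_mulDr : right_distributive clifford_mul clifford_add.
Proof.
elim/clifford_ind=> x; elim/clifford_ind=> y; elim/clifford_ind=> z.
by rewrite -clpiD -!clpiM -clpiD; apply: clpiE; exact: cl_mulDr.
Qed.

HB.instance Definition _ := GRing.Zmodule_isPzRing.Build clifford
  clifford_mulA clifford_mul1 clifford_mulr1 clifford_mulDl clifford_mulDr.

Definition clifford_scale (c : R[i]) (x : clifford) : clifford := cl_cst c * x.

Fact clifford_scaleA c d x :
  clifford_scale c (clifford_scale d x) = clifford_scale (c * d) x.
Proof.
rewrite /clifford_scale mulrA; congr (_ * _).
by rewrite /cl_cst (clpiE (cl_cstM c d)) clpiM.
Qed.
Fact clifford_scale1 : left_id 1 clifford_scale.
Proof. exact: clifford_mul1. Qed.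
Fact clifford_scaleDr : right_distributive clifford_scale +%R.
Proof. by move=> c x y; exact: mulrDr. Qed.
Fact clifford_scaleDl x : {morph clifford_scale^~ x : c d / c + d}.
Proof.
move=> c d; rewrite /clifford_scale -mulrDl; congr (_ * _).
by rewrite /cl_cst (clpiE (cl_cstD c d)) clpiD.
Qed.

HB.instance Definition _ := GRing.Zmodule_isLmodule.Build R[i] clifford
  clifford_scaleA clifford_scale1 clifford_scaleDr clifford_scaleDl.

Fact cl_gen_rel (u v : V) :
  cl_gen u * cl_gen v + cl_gen v * cl_gen u = (b u v)%:C%C *: (1 : clifford).
Proof.
transitivity (cl_cst (b u v)%:C%C); last by symmetry; exact: clifford_mulr1.
rewrite -[cl_cst _](clpiE (cl_clifford u v)) clpiD !clpiM.
by [].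
Qed.

(* The even (i = false) or odd (i = true) part: the complex span of the
   products of an even or odd number of generators. *)
Definition clifford_part (i : bool) : set clifford :=
  [set a | exists s : seq (R[i] * seq V),
     all (fun p => odd (size p.2) == i) s /\
     a = \sum_(p <- s) p.1 *: \prod_(v <- p.2) cl_gen v].

End Clifford.

Arguments clifford {R V} b.

Section VectorFields.
Variables (R : realType) (M : manifold R).
Implicit Types X : C^oo(M) -> C^oo(M).

(* Vector fields on M, as derivations of the algebra of smooth functions. *)
Definition vector_field X : Prop :=
  [/\ forall f h, X (f + h) = X f + X h,
      forall (a : R) f, X (smoothf_cst M (a : real_scalars R) * f) =
        smoothf_cst M (a : real_scalars R) * X f &
      forall f h, X (f * h) = X f * h + f * X h].

Variables (K : scalars R) (E : vbundle M K).

(* The values of nabla outside vector fields are irrelevant. *)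
Record connection (nabla : (C^oo(M) -> C^oo(M)) -> Gamma(E) -> Gamma(E)) : Prop := {
  connection_add : forall X s t, vector_field X ->
    nabla X (s + t) = nabla X s + nabla X t;
  connection_scale : forall X (c : K) s, vector_field X ->
    nabla X (smoothf_cst M c *: s) = smoothf_cst M c *: nabla X s;
  connection_leibniz : forall X (f : C^oo(M)) s, vector_field X ->
    nabla X (smoothf_of_real f *: s) =
      smoothf_of_real (X f) *: s + smoothf_of_real f *: nabla X s;
  connection_linear : forall X Y (f h : C^oo(M)) s,
    vector_field X -> vector_field Y ->
    nabla (fun u => f * X u + h * Y u) s =
      smoothf_of_real f *: nabla X s + smoothf_of_real h *: nabla Y s }.

End VectorFields.

Definition metric_connection (R : realType) (M : manifold R)
    (E : real_bundle M) (g : fibre_metric E)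
    (nabla : (C^oo(M) -> C^oo(M)) -> Gamma(E) -> Gamma(E)) : Prop :=
  connection nabla /\
  forall X s t, vector_field X ->
    X (metric_section g s t) =
      metric_section g (nabla X s) t + metric_section g s (nabla X t).

Section DifferentialOperators.
Variables (R : realType) (M : manifold R) (S : complex_bundle M).
Implicit Types D : Gamma(S) -> Gamma(S).

Definition complex_linear D : Prop :=
  (forall s t, D (s + t) = D s + D t) /\
  (forall (c : R[i]) s,
     D (smoothf_cst M (c : complex_scalars R) *: s) =
     smoothf_cst M (c : complex_scalars R) *: D s).

Fixpoint diffop_order (k : nat) D : Prop :=
  forall f : smoothf M (complex_scalars R),
    let C := fun s => D (f *: s) - f *: D s in
    if k is k'.+1 then diffop_order k' C else C = 0.

Definition diffop : set (Gamma(S) -> Gamma(S)) :=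
  [set D | complex_linear D /\ exists k, diffop_order k D].

Definition complex_subspace (A : set (Gamma(S) -> Gamma(S))) : Prop :=
  [/\ A 0, forall D D', A D -> A D' -> A (D + D') &
      forall (c : R[i]) D, A D ->
        A (fun s => smoothf_cst M (c : complex_scalars R) *: D s)].

End DifferentialOperators.

Arguments diffop {R M} S.

Section Spinors.
Variables (R : realType) (M : manifold R) (E : real_bundle M).
Variable g : fibre_metric E.

(* The smooth structure of the Clifford bundle is generated by that of E, so
   that smoothness of the isomorphism is smoothness of its restriction to E. *)
Record spinor_bundle := SpinorBundle {
  spinors :> complex_bundle M;
  spinor_iso : forall x, clifford (@metric _ _ _ g x) -> 'End(spinors x);
  spinor_iso_linear : forall x (c : R[i]) a b,
    @spinor_iso x (c *: a + b) = c *: spinor_iso a + spinor_iso b;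
  spinor_iso_mul : forall x a b,
    @spinor_iso x (a * b) = (spinor_iso a \o spinor_iso b)%VF;
  spinor_iso_one : forall x, @spinor_iso x 1 = \1%VF;
  spinor_iso_bij : forall x, bijective (@spinor_iso x);
  spinor_iso_smooth : forall (W : set M) (xi : forall x, E x)
      (s : forall x, spinors x), open W ->
    smooth_section W xi -> smooth_section W s ->
    smooth_section W (fun x => spinor_iso (cl_gen _ (xi x)) (s x)) }.

Variable S : spinor_bundle.
Local Notation op := (Gamma(S) -> Gamma(S)).

Definition gamma (xi : Gamma(E)) : op := fun s =>
  Section (spinor_iso_smooth openT (sectionP xi) (sectionP s)).

Definition spinor_connection
    (nabla : (C^oo(M) -> C^oo(M)) -> Gamma(S) -> Gamma(S)) : Prop :=
  connection nabla /\
  exists2 nablaE, metric_connection g nablaE &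
    forall X xi s, vector_field X ->
      nabla X (gamma xi s) - gamma xi (nabla X s) = gamma (nablaE X xi) s.

(* The even or odd sections of the complex Clifford bundle, as operators. *)
Definition clifford_section (i : bool) : set op :=
  [set A : op | exists a : forall x, clifford (@metric _ _ _ g x),
     (forall x, clifford_part i (a x)) /\
     forall (s : Gamma(S)) x, A s x = spinor_iso S (a x) (s x)].

(* P false is the even and P true the odd part. *)
Record spinor_grading (P : bool -> set op) : Prop := {
  grading_sub : forall i, P i `<=` diffop S;
  grading_subspace : forall i, complex_subspace (P i);
  grading_sum : forall D, diffop S D ->
    exists D0 D1, [/\ P false D0, P true D1 & D = D0 + D1];
  grading_direct : P false `&` P true `<=` [set 0];
  grading_mul : forall i j D D', P i D -> P j D' -> P (i (+) j) (D \o D');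
  grading_nabla : forall nabla X, spinor_connection nabla ->
    vector_field X -> P false (nabla X);
  grading_clifford : forall i, clifford_section i `<=` P i }.

Variable P : bool -> set op.

(* The homogeneous component of degree i; unique when P is a grading. *)
Definition hpart (i : bool) (D : op) : op :=
  xget 0 [set D' | P i D' /\ P (~~ i) (D - D')].

(* The bilinear extension of AB - (-1)^{|A||B|} BA. *)
Definition gcomm (A B : op) : op :=
  \sum_(i : bool) \sum_(j : bool)
    (hpart i A \o hpart j B - (hpart j B \o hpart i A) *~ (-1) ^+ (i && j)).

Fixpoint spin_filtration_nat (k : nat) : set op :=
  [set D | diffop S D /\ forall xi : Gamma(E),
     if k is k'.+1 then spin_filtration_nat k' (gcomm D (gamma xi))
     else gcomm D (gamma xi) = 0].

(* Zero in every negative degree. *)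
Definition spin_filtration (k : int) : set op :=
  match k with Posz n => spin_filtration_nat n | Negz _ => [set 0] end.

End Spinors.

(* Main.v *)
Require Import Defs.
From HB Require Import structures.
From mathcomp Require Import all_boot all_order all_algebra.
From mathcomp Require Import boolp classical_sets functions cardinality reals.
From mathcomp Require Import topology normedtype derive sequences realfun exp.
From mathcomp Require Import complex ring lra.
From Stdlib Require Ncring Ncring_tac.
Set Implicit Arguments.
Unset Strict Implicit.
Unset Printing Implicit Defensive.
Import Order.TTheory GRing.Theory Num.Theory.
Import numFieldNormedType.Exports.
Local Open Scope classical_set_scope.
Local Open Scope ring_scope.

(* For odd [g] write [ad g A = A * g - g * parity A], the supercommutator with
   [g].  That the filtration is multiplicative is the Leibniz rule for [ad g].

   Exhaustion.  As [ad xi] and [ad eta] anticommute up to the commutator with the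
   function [g(xi, eta)], on operators commuting with functions [ad] is
   alternating and linear over functions in the sections of [E]; localizing with
   bump functions, [rank E + 1] successive [ad]'s kill such operators.  Since [ad]
   commutes with taking the commutator with a function, [rank E + 1] successive
   [ad]'s lower the order of any differential operator.

   Commutators.  The Jacobi identity reduces the claim to total weight at most 1.
   An operator of weight at most 1 commutes with the functions [g(f xi, eta)],
   hence with [f], hence acts fibrewise.  The odd part of an operator of weight 0
   anticommutes with all Clifford generators; fibrewise it is then an even
   Clifford element, so it vanishes.  The even part commutes with all generators,
   hence with all fibre endomorphisms. *)

(** * Smooth functions on euclidean space *)

Section DirectionalChainRule.
Variables (R : realType) (V : normedModType R).
Implicit Types (f : V -> R) (phi : R -> R).

Let line f (a v : V) : R -> R := fun h => f (h *: v + a).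

Let lineE f a v : (fun h : R => h^-1 *: ((f \o shift a) (h *: v) - f a)) =
  (fun h : R => h^-1 *: ((line f a v \o shift 0) (h *: 1) - line f a v 0)).
Proof.
apply/funext => h; rewrite /line /= scale0r add0r addr0.
by rewrite [h *: 1]mulr1.
Qed.

Let is_derive_line f a v b : is_derive a v f b <-> is_derive (0 : R) 1 (line f a v) b.
Proof.
by split=> -[df <-]; (split; last by rewrite /derive lineE);
  move: df; rewrite /derivable lineE.
Qed.

(** The derivative of [f] at [a] along [v] is the ordinary derivative at 0 of [line f a v], and
    [line] commutes with post-composition by [phi], so the one-variable chain rule applies. *)
Lemma is_derive_comp phi f a v c b :
  is_derive (f a) 1 phi c -> is_derive a v f b ->
  is_derive a v (phi \o f) (c * b).
Proof.
move=> dphi /is_derive_line df; apply/is_derive_line.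
have -> : line (phi \o f) a v = phi \o line f a v by [].
apply: is_derive1_comp.
by rewrite /line scale0r add0r.
Qed.

End DirectionalChainRule.

(** * Flat functions of one variable *)

Section Flat.
Variable R : realType.
Implicit Types (t : R) (m : nat).

(** The powers of [t^-1] make the span of the family closed under differentiation, so smoothness of
    [flat 0] follows by an induction over all [m] at once. *)
Definition flat m t : R := if 0 < t then t^-1 ^+ m * expR (- t^-1) else 0.

Lemma flat_gt0 m t : 0 < t -> 0 < flat m t.
Proof.
by move=> t0; rewrite /flat t0 mulr_gt0 ?expR_gt0 ?exprn_gt0 ?invr_gt0.
Qed.

Lemma flat_le0 m t : t <= 0 -> flat m t = 0.
Proof. by move=> t0; rewrite /flat ltNge t0. Qed.

(** For [u = t^-1 > 0] this says that [u ^+ m.+2 / m.+2!] is at most [expR u], being one term of its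
    series. The exponent 2 gives derivability at the origin. *)
Lemma flat_bound m t : `|flat m t| <= m.+2`!%:R * `|t| ^+ 2.
Proof.
have [t0|t0] := lerP t 0.
  by rewrite flat_le0// normr0 mulr_ge0// ?ler0n// exprn_ge0.
rewrite ger0_norm ?(ltW (flat_gt0 _ _))// gtr0_norm// /flat t0.
have [u u0 ->] : exists2 u : R, 0 < u & t = u^-1.
  by exists t^-1; rewrite ?invr_gt0 ?invrK.
rewrite invrK expRN ler_pdivrMr ?expR_gt0// exprVn mulrAC.
rewrite ler_pdivlMr ?exprn_gt0//.
rewrite -exprD addn2 mulrC -ler_pdivrMr ?ltr0n ?fact_gt0//.
apply: le_trans (expR_ge1Dxn m.+1 (ltW u0)).
by rewrite lerDr ler01.
Qed.

Lemma is_derive_flat m t :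
  is_derive t 1 (flat m) (flat m.+2 t - m%:R * flat m.+1 t).
Proof.
have [t0|t0|->] := ltgtP t 0.
- rewrite !flat_le0 ?(ltW t0)// mulr0 subrr.
  apply: (near_eq_is_derive (f := cst 0)).
  by near=> s; rewrite flat_le0//; apply: ltW; near: s; exact: lt_nbhsl.
- apply: (near_eq_is_derive
      (f := (fun s : R => s^-1) ^+ m * (expR \o (fun s : R => - s^-1)))).
    near=> s; rewrite /flat ifT; last by near: s; exact: lt_nbhsr.
    by rewrite fctE /= fctE.
  have dV : is_derive t (1 : R) (fun s : R => s^-1) (- t ^- 2 *: 1).
    by apply: is_deriveV => //; rewrite gt_eqF.
  have dN : is_derive t (1 : R) (fun s : R => - s^-1) (- (- t ^- 2 *: 1)).
    exact: is_deriveN.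
  apply: is_derive_eq; rewrite /flat t0 /= !fctE /=.
  rewrite /GRing.scale /= !exprVn.
  have tn0 : t != 0 by rewrite gt_eqF.
  case: m => [|m] /=.
    by rewrite !expr0 expr1; field.
  by rewrite !exprS expr0; field; rewrite tn0 expf_neq0.
- rewrite !flat_le0// mulr0 subrr.
  (* By [flat_bound] the difference quotient at the origin is at most a constant times [|h|]. *)
  suff lim0 : (fun h : R => h^-1 *: ((flat m \o shift 0) (h *: (1 : R)) - flat m 0))
      @ 0^' --> (0 : R).
    by split; [apply/cvg_ex; exists 0 | exact: cvg_lim lim0].
  apply/cvgrPdist_le => e e0; near=> h.
  rewrite sub0r normrN [shift _]/shift /= addr0 [h *: 1]mulr1.
  rewrite (flat_le0 _ (lexx 0)) subr0 normrZ normrV ?unitfE//; last first.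
    by near: h; exact: nbhs_dnbhs_neq.
  have h0 : h != 0 by near: h; exact: nbhs_dnbhs_neq.
  rewrite ler_pdivrMl ?normr_gt0// (le_trans (flat_bound _ _))//.
  rewrite expr2 mulrA mulrC ler_pM2l ?normr_gt0//.
  rewrite -ler_pdivlMl ?ltr0n ?fact_gt0//.
  near: h; apply: dnbhs0_le.
  by rewrite mulr_gt0// invr_gt0 ltr0n fact_gt0.
Unshelve. all: by end_near.
Qed.

Lemma continuous_flat m : continuous (flat m).
Proof.
move=> t; apply/differentiable_continuous/derivable1_diffP.
by case: (is_derive_flat m t).
Qed.

End Flat.

Section CkMore.
Variables (R : realType) (n : nat).
Implicit Types (U : set 'rV[R]_n) (f : 'rV[R]_n -> R).

Lemma Ck_setU k U U' f : open U -> open U' ->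
  Ck k U f -> Ck k U' f -> Ck k (U `|` U') f.
Proof.
move=> oU oU'; elim: k f => [|k IH] f [cf df] [cf' df'].
all: split; first by move=> y [/cf|/cf'].
  by [].
move=> i; have [d1 c1] := df i; have [d2 c2] := df' i.
by split=> [y [/d1|/d2]//|]; exact: IH.
Qed.

(** Induction on [k] with [m] general: the partial derivatives involve [flat m.+2] and [flat m.+1]
    composed with [f], times a partial derivative of [f]. *)
Lemma Ck_flat k U f m : open U -> Ck k U f -> Ck k U (flat m \o f).
Proof.
move=> oU; elim: k f m => [|k IH] f m Cf; move: (Cf) => [cf df].
all: split; first by
  move=> y Uy; apply: continuous_comp; [exact: cf|exact: continuous_flat].
  by [].
move=> i; have [dfi Ci] := df i.
have chain y : U y -> is_derive y (delta_mx ord0 i) (flat m \o f)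
    ((flat m.+2 (f y) - m%:R * flat m.+1 (f y)) * 'D_(delta_mx ord0 i) f y).
  move=> Uy; apply: is_derive_comp; first exact: is_derive_flat.
  exact/derivableP/dfi.
split=> [y /chain[]//|].
pose F := ((flat m.+2 \o f) + (cst (- m%:R)) * (flat m.+1 \o f)) *
  (fun y => 'D_(delta_mx ord0 i) f y).
apply: (@Ck_ext _ _ _ _ F) => //.
  move=> y; rewrite inE => /chain dy; rewrite derive_val.
  by rewrite /F !fctE /= mulNr.
apply: CkM => //; apply: CkD => //; last apply: CkM => //.
- exact/IH/CkW.
- exact: Ck_cst.
- exact/IH/CkW.
Qed.

Lemma Ck_sum k U (I : Type) (s : seq I) (F : I -> 'rV[R]_n -> R) : open U ->
  (forall i, Ck k U (F i)) -> Ck k U (\sum_(i <- s) F i).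
Proof.
move=> oU CF; elim/big_ind : _ => //; last by move=> ? ? ? ?; exact: CkD.
exact: (@Ck_cst R n k U 0).
Qed.

End CkMore.

(** * Cutoff functions and frames *)

Section SmoothLocal.
Variables (R : realType) (M : manifold R).
Implicit Types W : set M.

Lemma smooth_on_ext W (f h : M -> R) : open W -> (forall x, W x -> f x = h x) ->
  smooth_on W f -> smooth_on W h.
Proof.
move=> oW fh sf c k; apply: Ck_ext (sf c k); first exact: cimgI_open.
by move=> y; rewrite inE => -[x [cx Wx] <-] /=; rewrite cmapK// fh.
Qed.

Lemma smooth_on_setU W W' (f : M -> R) : open W -> open W' ->
  smooth_on W f -> smooth_on W' f -> smooth_on (W `|` W') f.
Proof.
move=> oW oW' sf sf' c k; rewrite setIUr image_setU.
by apply: Ck_setU; [exact: cimgI_open|exact: cimgI_open|exact: sf|exact: sf'].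
Qed.

Variable K : scalars R.

Lemma smooth_ext W (f h : M -> K) : open W -> (forall x, W x -> f x = h x) ->
  smooth W f -> smooth W h.
Proof.
by move=> oW fh [sf1 sf2]; split; [apply: smooth_on_ext sf1|apply: smooth_on_ext sf2];
  move=> // x /fh ->.
Qed.

Lemma smooth_setU W W' (f : M -> K) : open W -> open W' ->
  smooth W f -> smooth W' f -> smooth (W `|` W') f.
Proof. by move=> oW oW' [? ?] [? ?]; split; exact: smooth_on_setU. Qed.

Definition supported_in (rho : C^oo(M)) (U : set M) :=
  exists C : set M, [/\ closed C, C `<=` U & forall y, ~ C y -> rho y = 0].

(** Extension by zero: the product is smooth on [U] and vanishes off the closed set [C], and [U]
    together with the complement of [C] covers [M]. *)
Lemma smooth_cutoff (rho : C^oo(M)) U W (f : M -> K) : open U -> open W ->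
  supported_in rho U -> smooth (U `&` W) f ->
  smooth W (fun x => smoothf_of_real rho x * f x : K).
Proof.
move=> oU oW [C [cC CU rho0]] sf.
have oUW : open (U `&` W) by exact: openI.
have oCW : open (~` C `&` W) by apply: openI => //; exact: closed_openC.
apply: (smooth_sub (W' := (U `&` W) `|` (~` C `&` W))) => //.
  by move=> x Wx; have [/CU Ux|nCx] := pselect (C x); [left|right].
apply: smooth_setU => //.
- apply: (smoothM (f := smoothf_of_real rho : M -> K)) => //.
  exact: (smooth_sub _ _ (smoothfP _)).
- apply: (smooth_ext (f := cst (0 : K))) => //; last exact: smooth_cst.
  by move=> x [nCx _] /=; rewrite rho0// rmorph0 mul0r.
Qed.

(** In a chart, [flat 0] is composed with a quadratic polynomial [q] that is positive only inside a
    compact box. The image of the box in [M] is closed because [M] is Hausdorff. *)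
Lemma exists_bump U (x : M) : open U -> U x ->
  exists2 rho : C^oo(M), rho x != 0 & supported_in rho U.
Proof.
move=> oU Ux; have [c cx] := cdom_cover x.
have oV : open (cmap c @` (cdom c `&` U)) by exact: cimgI_open.
set V := cmap c @` _ in oV; set y0 := cmap c x.
have : nbhs y0 V by apply: open_nbhs_nbhs; split=> //; exists x.
move=> /nbhs_ballP[d /= d0 dV].
(* Balls of row vectors are cubes, so the box of half-width [d / 2] lies in the ball of radius [d],
   hence in [V]. *)
pose box := [set v : 'rV[R]_(mdim M) | forall i,
  `[y0 ord0 i - d / 2, y0 ord0 i + d / 2]%classic (v ord0 i)].
have cbox : compact box.
  apply: (@rV_compact R _ (fun i => `[y0 ord0 i - d / 2, y0 ord0 i + d / 2]%classic)).
  by move=> i; exact: segment_compact.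
have boxV : box `<=` V.
  move=> v bv; apply: dV; split=> // i j; rewrite (ord1 i); have := bv j.
  rewrite /= in_itv /= => /andP[v1 v2]; rewrite /ball /= ltr_norml.
  by apply/andP; split; lra.
pose q (v : 'rV[R]_(mdim M)) := (d / 2) ^+ 2 - \sum_i (v ord0 i - y0 ord0 i) ^+ 2.
have qbox v : 0 < q v -> box v.
  rewrite subr_gt0 => qv i /=; rewrite in_itv /=.
  have : (v ord0 i - y0 ord0 i) ^+ 2 < (d / 2) ^+ 2.
    apply: le_lt_trans qv; rewrite (bigD1 i)//= lerDl.
    by apply: sumr_ge0 => j _; exact: sqr_ge0.
  rewrite -[X in X < _]real_normK ?num_real// ltr_sqr ?nnegrE ?normr_ge0 ?divr_ge0 ?(ltW d0)//.
  by rewrite ltr_norml => /andP[? ?]; apply/andP; split; lra.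
pose f z := if pselect (cdom c z) then flat 0 (q (cmap c z)) else 0.
pose C := cinv c @` box.
have Vimg : V `<=` cmap c @` cdom c by move=> _ [z [cz _] <-]; exists z.
have cC : closed C.
  apply: compact_closed; first exact: manifold_hausdorff.
  apply: continuous_compact => //.
  apply: continuous_in_subspaceT => v; rewrite inE => /boxV/Vimg.
  exact: cinv_continuous.
have CU : C `<=` cdom c `&` U.
  by move=> _ [v /boxV [z [cz Uz] <-] <-]; rewrite cmapK.
have f0 z : ~ C z -> f z = 0.
  rewrite /f; case: pselect => // cz nCz; rewrite flat_le0// leNgt.
  by apply/negP => /qbox bz; apply: nCz; exists (cmap c z) => //; rewrite cmapK.
(* Read in another chart [e], [f] is [flat 0] of a polynomial [p] in the coordinates of the
   transition map. *)
have sfc : smooth_on (cdom c) f.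
  move=> e k; have oW : open (cmap e @` (cdom e `&` cdom c)).
    by apply: cimgI_open; exact: cdom_open.
  pose p := cst ((d / 2) ^+ 2) + cst (-1) * \sum_(i <- index_enum 'I_(mdim M))
    (((fun y => cmap c (cinv e y) ord0 i) + cst (- y0 ord0 i)) *
     ((fun y => cmap c (cinv e y) ord0 i) + cst (- y0 ord0 i)))
    : 'rV[R]_(mdim M) -> R.
  apply: (@Ck_ext _ _ _ _ (flat 0 \o p)) => //.
    move=> y; rewrite inE => -[z [ez cz] <-] /=; rewrite /f cmapK//.
    case: pselect => //= _; congr flat; rewrite /p /q !fctE mulN1r.
    congr (_ - _); rewrite fct_sumE; apply: eq_bigr => i _.
    by rewrite !fctE /= cmapK// expr2.
  apply: Ck_flat => //; apply: CkD => //; first exact: Ck_cst.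
  apply: CkM => //; first exact: Ck_cst.
  apply: Ck_sum => // i.
  have Ci : Ck k (cmap e @` (cdom e `&` cdom c))
      ((fun y => cmap c (cinv e y) ord0 i) + cst (- y0 ord0 i)).
    by apply: CkD => //; [exact: transition_smooth|exact: Ck_cst].
  exact: CkM.
have sf : smooth_on setT f.
  have oC : open (~` C) by exact: closed_openC.
  apply: (@smooth_on_sub _ _ _ (cdom c `|` ~` C)).
  - exact: openT.
  - by move=> z _; have [/CU[]|] := pselect (C z); [left|right].
  - apply: smooth_on_setU => //; first exact: cdom_open.
    apply: (@smooth_on_ext _ (cst 0)) => //; first by move=> z /f0.
    exact: smooth_on_cst.
have sf' : smooth setT (f : M -> real_scalars R).
  by split => //; exact: smooth_on_cst.
exists (mk_smoothf sf'); last first.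
  by exists C; split=> // z /CU[].
rewrite /= /f; case: pselect => //= _; rewrite gt_eqF//.
apply: flat_gt0; rewrite /q big1 ?subr0 ?exprn_gt0 ?divr_gt0//.
by move=> i _; rewrite subrr expr0n.
Qed.

End SmoothLocal.

(** * Local frames and extension of sections *)

Section LocalFrame.
Variables (R : realType) (M : manifold R) (K : scalars R) (E : vbundle M K).

Lemma section_sumE (I : Type) (r : seq I) (s : I -> Gamma(E)) x :
  (\sum_(i <- r) s i) x = \sum_(i <- r) s i x.
Proof. by elim/big_rec2 : _ => // i y1 y2 _ <-. Qed.

Lemma smooth_section_cutoff (rho : C^oo(M)) U (s : forall x, E x) : open U ->
  supported_in rho U -> smooth_section U s ->
  smooth_section setT (fun x => smoothf_of_real (K := K) rho x *: s x).
Proof.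
move=> oU sU ss a i.
rewrite (_ : (fun _ => _) =
  fun x => smoothf_of_real rho x * tmap a x (s x) ord0 i :> K); last first.
  by apply/funext => x; rewrite linearZ mxE.
have oW : open (tdom a `&` setT) by apply: openI; [exact: tdom_open|exact: openT].
apply: (smooth_cutoff oU) => //.
rewrite setIT setIC; exact: ss.
Qed.

Definition frame (a : vtriv E) (i : 'I_(vrank E)) x : E x :=
  xget 0 [set v | tmap a x v = delta_mx ord0 i].

Lemma tmap_frame a i x : tdom a x -> tmap a x (frame a i x) = delta_mx ord0 i.
Proof.
move=> ax; have [h hK Kh] := tmap_bij ax.
by rewrite /frame; case: xgetP => // /(_ (h (delta_mx ord0 i)))[]; exact: Kh.
Qed.

Lemma frame_sum a x (v : E x) : tdom a x ->
  v = \sum_i tmap a x v ord0 i *: frame a i x.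
Proof.
move=> ax; apply: (bij_inj (tmap_bij ax)).
rewrite linear_sum [LHS]row_sum_delta; apply: eq_bigr => i _.
by rewrite linearZ /= tmap_frame.
Qed.

(** In the trivialization [b] the coordinates of [frame a i] form row [i] of the transition
    matrix. *)
Lemma frame_smooth a i : smooth_section (tdom a) (frame a i).
Proof.
move=> b j; have [T [sT TE]] := transition_matrix a b.
have oba : open (tdom b `&` tdom a) by apply: openI; exact: tdom_open.
apply: (smooth_ext (f := fun x => T x i j : K)) => //.
  by move=> x [bx ax]; rewrite TE// tmap_frame// -rowE mxE.
by rewrite setIC; exact: sT.
Qed.

(** Cutoffs make a local frame global at the price of the factor [r], which can be cancelled at [x].
    The last clause serves to show that operators commuting with functions act fibrewise. *)
Lemma global_frame x :
  exists (r : smoothf M K) (e : 'I_(vrank E) -> Gamma(E))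
         (c : Gamma(E) -> 'I_(vrank E) -> smoothf M K),
  [/\ r x != 0, forall s : Gamma(E), r *: s = \sum_i c s i *: e i &
      forall s : Gamma(E), s x = 0 -> forall i, c s i x = 0].
Proof.
have [a ax] := tdom_cover E x.
have oa := tdom_open a.
have [rho rx sa] := exists_bump oa ax.
pose r := smoothf_of_real (K := K) rho.
pose e i := Section (smooth_section_cutoff oa sa (@frame_smooth a i)).
have sc (s : Gamma(E)) i : smooth setT (fun y => r y * tmap a y (s y) ord0 i : K).
  apply: (smooth_cutoff oa) => //; first exact: openT.
  by rewrite setIT; have := sectionP s a i; rewrite setIT.
(* One factor of the cutoff globalizes the frame sections and the other the coefficients, whence the
   square. *)
exists (r * r), e, (fun s i => mk_smoothf (sc s i)); split.
- by rewrite mulf_neq0// fmorph_eq0.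
- move=> s; apply: section_eq => y; rewrite section_sumE.
  rewrite -[LHS]/((r y * r y) *: s y).
  have [C [cC Ca rho0]] := sa.
  have [/Ca ay|nCy] := pselect (C y); last first.
    have r0 : r y = 0 by rewrite /= rho0// rmorph0.
    by rewrite r0 mul0r scale0r big1// => i _; rewrite /= rho0// rmorph0 scale0r scaler0.
  rewrite [in LHS](frame_sum (s y) ay) scaler_sumr; apply: eq_bigr => i _ /=.
  by rewrite !scalerA; congr (_ *: _); rewrite mulrAC.
- by move=> s sx i /=; rewrite sx linear0 mxE mulr0.
Qed.

Lemma section_extend x (v : E x) : exists s : Gamma(E), s x = v.
Proof.
have [a ax] := tdom_cover E x.
have oa := tdom_open a.
have [rho rx sa] := exists_bump oa ax.
pose e i := Section (smooth_section_cutoff oa sa (@frame_smooth a i)).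
(* Dividing by [rho x] compensates for the cutoff contained in [e i]. *)
exists (\sum_i smoothf_cst M (tmap a x v ord0 i / of_real (rho x)) *: e i).
rewrite section_sumE [RHS](frame_sum v ax); apply: eq_bigr => i _ /=.
by rewrite scalerA divfK// fmorph_eq0.
Qed.

End LocalFrame.

(** * Filtrations of superalgebras *)

#[local] Instance pzRing_ops (A : pzRingType) :
  @Ncring.Ring_ops A 0 1 +%R *%R (fun x y => x - y) -%R eq := {}.

#[local] Instance pzRing_ncring (A : pzRingType) : Ncring.Ring (Ro := pzRing_ops A).
Proof.
split; by [|move=> ? ? ->|move=> ? ? -> ? ? ->|exact: add0r|exact: addrC|
  exact: addrA|exact: mul1r|exact: mulr1|exact: mulrA|exact: mulrDl|
  exact: subrr|move=> x y z; exact: mulrDr|exact: RelationClasses.eq_equivalence].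
Qed.

Ltac ncring := Ncring_tac.non_commutative_ring.

Record graded_ring (A : pzRingType) (G : bool -> set A) : Prop := {
  graded0 : forall i, G i 0;
  gradedB : forall i a b, G i a -> G i b -> G i (a - b);
  gradedM : forall i j a b, G i a -> G j b -> G (i (+) j) (a * b);
  graded_sum : forall a, exists a0 a1, [/\ G false a0, G true a1 & a = a0 + a1];
  graded_direct : forall a, G false a -> G true a -> a = 0 }.

Section GradedRing.
Variables (A : pzRingType) (G : bool -> set A).
Hypothesis hG : graded_ring G.
Implicit Types (a b c g h : A) (i j : bool).

Definition part i a : A := xget 0 [set a' | G i a' /\ G (~~ i) (a - a')].

Lemma gradedN i a : G i a -> G i (- a).
Proof. by move=> Ga; rewrite -sub0r; apply: gradedB => //; exact: graded0. Qed.

Lemma gradedD i a b : G i a -> G i b -> G i (a + b).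
Proof. by move=> Ga Gb; rewrite -(opprK b); apply: gradedB => //; exact: gradedN. Qed.

Lemma part_spec i a : G i (part i a) /\ G (~~ i) (a - part i a).
Proof.
rewrite /part; case: xgetP => [b _ []//|].
have [a0 [a1 [G0 G1 ->]]] := graded_sum hG a.
case: i => /=; first by move=> /(_ a1)[]; rewrite addrK.
by move=> /(_ a0)[]; rewrite addrC addKr.
Qed.

Lemma partE i a b : G i b -> G (~~ i) (a - b) -> part i a = b.
Proof.
move=> Gb Gab; have [Gp Gap] := part_spec i a.
apply: subr0_eq.
have Gi : G i (part i a - b) by exact: gradedB.
have Gn : G (~~ i) (part i a - b).
  by rewrite (_ : _ - b = (a - b) - (a - part i a)); [exact: gradedB|ncring].
by case: i Gi Gn {Gb Gab Gp Gap} => /= G1 G2; exact: (graded_direct hG).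
Qed.

Lemma part_eq a0 a1 : G false a0 -> G true a1 ->
  (part false (a0 + a1) = a0) * (part true (a0 + a1) = a1).
Proof. by move=> G0 G1; split; apply: partE; rewrite ?addrK//= addrC addKr. Qed.

Lemma partG i a : G i (part i a).
Proof. by case: (part_spec i a). Qed.

Lemma part_sum a : a = part false a + part true a.
Proof. by have [a0 [a1 [G0 G1 ->]]] := graded_sum hG a; rewrite !part_eq. Qed.

(* Locked, lest [parityB] rewrite the inner occurrence in [parity (parity a)]. *)
Definition parity a : A := locked (part false a - part true a).

Lemma parity_eq a0 a1 : G false a0 -> G true a1 -> parity (a0 + a1) = a0 - a1.
Proof. by move=> G0 G1; rewrite /parity -lock !part_eq. Qed.

Lemma parity_even a : G false a -> parity a = a.
Proof.
by move=> Ga; rewrite -{1}[a]addr0 parity_eq ?subr0//; exact: graded0.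
Qed.

Lemma parity_odd a : G true a -> parity a = - a.
Proof.
by move=> Ga; rewrite -{1}[a]add0r parity_eq ?add0r//; exact: graded0.
Qed.

Lemma parity_sign i a : G i a -> parity a = (-1) ^+ i * a.
Proof.
by case: i => Ga; rewrite ?mulN1r ?mul1r; [exact: parity_odd|exact: parity_even].
Qed.

Lemma partP a : exists a0 a1, [/\ G false a0, G true a1, part false a = a0,
  part true a = a1 & a = a0 + a1].
Proof.
by exists (part false a), (part true a); split; rewrite -?part_sum//; exact: partG.
Qed.

Lemma parityB a b : parity (a - b) = parity a - parity b.
Proof.
have [a0 [a1 [Ga0 Ga1 _ _ ->]]] := partP a.
have [b0 [b1 [Gb0 Gb1 _ _ ->]]] := partP b.
rewrite (_ : _ - _ = (a0 - b0) + (a1 - b1)); last ncring.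
by rewrite !parity_eq//; [ncring| |]; exact: gradedB.
Qed.

HB.instance Definition _ := GRing.isZmodMorphism.Build A A parity parityB.

Lemma parityM a b : parity (a * b) = parity a * parity b.
Proof.
have [a0 [a1 [Ga0 Ga1 _ _ ->]]] := partP a.
have [b0 [b1 [Gb0 Gb1 _ _ ->]]] := partP b.
rewrite (_ : _ * _ = (a0 * b0 + a1 * b1) + (a0 * b1 + a1 * b0)); last ncring.
rewrite !parity_eq//; first ncring.
- by apply: gradedD; [apply: (gradedM hG Ga0 Gb0)|apply: (gradedM hG Ga1 Gb1)].
- by apply: gradedD; [apply: (gradedM hG Ga0 Gb1)|apply: (gradedM hG Ga1 Gb0)].
Qed.

Lemma parityK : involutive parity.
Proof.
move=> a; have [a0 [a1 [Ga0 Ga1 _ _ ->]]] := partP a.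
by rewrite parity_eq// parityB parity_even// parity_odd// opprK.
Qed.

(** The same shape as [gcomm], so that the two agree as soon as homogeneous parts do. *)
Definition supercomm a b : A := \sum_(i : bool) \sum_(j : bool)
  (part i a * part j b - (part j b * part i a) *~ (-1) ^+ (i && j)).

(** For [b] of degree [j] the sign in the graded commutator depends only on the part of [a], and
    [iter j parity] applies it. *)
Lemma supercomm_sign j a b : G j b ->
  supercomm a b = a * b - b * iter j parity a.
Proof.
move=> Gb; rewrite /supercomm !big_bool /= expr0 expr1 !mulr1z !mulrN1z.
have [a0 [a1 [Ga0 Ga1 -> -> ->]]] := partP a.
have [-> ->] : part true b = (if j then b else 0) /\ part false b = (if j then 0 else b).
  by case: j Gb => Gb; split; apply: partE; rewrite ?subr0 ?subrr//; exact: graded0.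
case: j {Gb} => /=; last ncring.
rewrite (parity_eq Ga0 Ga1); ncring.
Qed.

Lemma supercommDr a b c : supercomm a (b + c) = supercomm a b + supercomm a c.
Proof.
have [b0 [b1 [Gb0 Gb1 pb0 pb1 ->]]] := partP b.
have [c0 [c1 [Gc0 Gc1 pc0 pc1 ->]]] := partP c.
rewrite (_ : _ + _ = (b0 + c0) + (b1 + c1)); last ncring.
rewrite /supercomm !big_bool /= !part_eq//; try exact: gradedD.
rewrite expr0 expr1 !mulr1z !mulrN1z; ncring.
Qed.

Definition ad g a : A := a * g - g * parity a.

Lemma supercomm_odd g a : G true g -> supercomm a g = ad g a.
Proof. by move=> Gg; rewrite (supercomm_sign _ Gg). Qed.

Lemma adB g a b : ad g (a - b) = ad g a - ad g b.
Proof. by rewrite /ad parityB; ncring. Qed.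

Lemma ad0 g : ad g 0 = 0.
Proof. by rewrite /ad raddf0 mul0r mulr0 subr0. Qed.

Lemma adN g a : ad g (- a) = - ad g a.
Proof. by rewrite -[- a]sub0r adB ad0 sub0r. Qed.

Lemma adD g a b : ad g (a + b) = ad g a + ad g b.
Proof. by rewrite -{1}(opprK b) adB adN opprK. Qed.

Lemma ad_parity g a : G true g -> ad g (parity a) = - parity (ad g a).
Proof.
move=> Gg; rewrite /ad parityB !parityM parityK (parity_odd Gg); ncring.
Qed.

Lemma adM g a b : ad g (a * b) = a * ad g b + ad g a * parity b.
Proof. by rewrite /ad parityM; ncring. Qed.

Lemma ad_genD g h a : ad (g + h) a = ad g a + ad h a.
Proof. by rewrite /ad; ncring. Qed.

Lemma ad_comm_even g c a : G false c -> c * g = g * c ->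
  ad g (a * c - c * a) = ad g a * c - c * ad g a.
Proof.
move=> Gc cg; apply: subr0_eq; rewrite /ad parityB !parityM (parity_even Gc).
transitivity (a * (c * g - g * c) + (g * c - c * g) * parity a); first ncring.
by rewrite cg subrr mulr0 mul0r addr0.
Qed.

Lemma adG g j a : G true g -> G j a -> G (~~ j) (ad g a).
Proof.
move=> Gg Ga; rewrite /ad (parity_sign Ga).
have Gag : G (~~ j) (a * g) by have := gradedM hG Ga Gg; rewrite addbT.
have Gga : G (~~ j) (g * a) by have := gradedM hG Gg Ga.
case: j {Ga} Gag Gga => Gag Gga; rewrite ?mulN1r ?mul1r; last exact: gradedB.
by rewrite mulrN opprK; exact: gradedD.
Qed.

(** In the expansion the terms with [parity a] in the middle cancel, because [parity] negates [g]
    and [h]. *)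
Lemma ad_anticomm g h a : G true g -> G true h ->
  ad g (ad h a) + ad h (ad g a) = a * (g * h + h * g) - (g * h + h * g) * a.
Proof.
move=> Gg Gh; rewrite /ad !parityB !parityM !parityK (parity_odd Gg) (parity_odd Gh).
ncring.
Qed.

(** The super Jacobi identity: [g] acts from the right, so reaching [a] costs the sign of passing
    [b]. *)
Lemma ad_supercomm g j a b : G true g -> G j b ->
  ad g (supercomm a b) =
    supercomm a (ad g b) + (-1) ^+ j * supercomm (ad g a) b.
Proof.
move=> Gg Gb; rewrite (supercomm_sign a Gb) (supercomm_sign (ad g a) Gb).
rewrite (supercomm_sign a (adG Gg Gb)).
case: j Gb => Gb /=; rewrite adB ?mulN1r ?mul1r /ad ?parityB ?parityM ?parityB
  ?parityM ?parityK ?(parity_odd Gg) ?(parity_odd Gb) ?(parity_even Gb); ncring.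
Qed.

(** * The filtration by iterated supercommutators *)

Variable gens : set A.
Hypothesis gens_odd : gens `<=` G true.

Fixpoint filt (k : nat) a : Prop := forall g, gens g ->
  if k is k'.+1 then filt k' (ad g a) else ad g a = 0.

Lemma filtS_ad k a g : filt k.+1 a -> gens g -> filt k (ad g a).
Proof. by move=> /[apply]. Qed.

Lemma filtB k a b : filt k a -> filt k b -> filt k (a - b).
Proof.
elim: k a b => [|k IH] a b fa fb g Gg; first by rewrite adB fa// fb// subrr.
by rewrite adB; apply: IH; [exact: fa|exact: fb].
Qed.

Lemma filt0 k : filt k 0.
Proof. by elim: k => [|k IH] g _; rewrite ad0. Qed.

Lemma filtN k a : filt k a -> filt k (- a).
Proof. by move=> fa; rewrite -sub0r; apply: filtB => //; exact: filt0. Qed.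

Lemma filtD k a b : filt k a -> filt k b -> filt k (a + b).
Proof. by move=> fa fb; rewrite -(opprK b); apply: filtB => //; exact: filtN. Qed.

Lemma filtW k a : filt k a -> filt k.+1 a.
Proof.
elim: k a => [|k IH] a fa g Gg; first by rewrite (fa g Gg); exact: (filt0 0). 
exact/IH/fa.
Qed.

(** Needed for products, since the Leibniz rule [adM] twists the second factor by [parity]. *)
Lemma filt_parity k a : filt k a -> filt k (parity a).
Proof.
elim: k a => [|k IH] a fa g Gg; rewrite ad_parity; try exact: gens_odd.
  by rewrite fa// raddf0 oppr0.
exact/filtN/IH/fa.
Qed.

(** As [ad g] exchanges the two degrees, it maps the parts of [a] to the parts of [ad g a]. *)
Lemma filt_part k i a : filt k a -> filt k (part i a).
Proof.
elim: k i a => [|k IH] i a fa g Gg.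
  have [a0 [a1 [Ga0 Ga1 pa0 pa1 aE]]] := partP a.
  have Gog := gens_odd Gg.
  have : ad g a1 + ad g a0 = 0 by rewrite -adD addrC -aE fa.
  move=> /eqP; rewrite addr_eq0 => /eqP e.
  have z0 : ad g a0 = 0.
    apply: (graded_direct hG); last exact: (adG Gog Ga0).
    by rewrite -[ad g a0]opprK -e; apply: gradedN; exact: (adG Gog Ga1).
  by case: i; rewrite ?pa0 ?pa1// e z0 oppr0.
have Gog := gens_odd Gg.
have -> : ad g (part i a) = part (~~ i) (ad g a).
  rewrite {2}(part_sum a) adD addrC.
  have [] := part_eq (adG Gog (partG true a)) (adG Gog (partG false a)).
  by case: i.
exact/IH/fa.
Qed.

(** Induction on [k + l]: each Leibniz term lowers the weight of one factor, or vanishes when that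
    factor has weight 0. *)
Lemma filtM k l a b : filt k a -> filt l b -> filt (k + l) (a * b).
Proof.
move: {2}(k + l)%N (erefl (k + l)%N) => n.
elim: n k l a b => [|n IH] k l a b klE fa fb; rewrite klE.
  move: klE fa fb => /eqP; rewrite addn_eq0 => /andP[/eqP-> /eqP->] fa fb g Gg.
  by rewrite adM fa// fb// mulr0 mul0r addr0.
move=> g Gg; rewrite adM; apply: filtD.
- case: l klE fb => [|l] klE fb; first by rewrite fb// mulr0; exact: filt0.
  have -> : n = (k + l)%N by apply: succn_inj; rewrite -klE addnS.
  by apply: IH; [apply: succn_inj; rewrite -klE addnS|exact: fa|exact: fb].
- case: k klE fa => [|k] klE fa; first by rewrite fa// mul0r; exact: filt0.
  have -> : n = (k + l)%N by apply: succn_inj; rewrite -klE addSn.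
  apply: IH; [by apply: succn_inj; rewrite -klE addSn|exact: fa|].
  exact: filt_parity.
Qed.

(* [filt_pred k] is the filtration in degree [k - 1], zero for [k = 0]. *)
Definition filt_pred k a : Prop := if k is k'.+1 then filt k' a else a = 0.

Lemma filt_predE k a : filt k a <-> forall g, gens g -> filt_pred k (ad g a).
Proof. by case: k. Qed.

Lemma filt_pred0 k : filt_pred k 0.
Proof. by case: k => [//|k]; exact: filt0. Qed.

Lemma filt_predN k a : filt_pred k a -> filt_pred k (- a).
Proof. by case: k => [->|k] /=; [rewrite oppr0|exact: filtN]. Qed.

Lemma filt_predD k a b : filt_pred k a -> filt_pred k b -> filt_pred k (a + b).
Proof. by case: k => [-> ->|k] /=; [rewrite addr0|exact: filtD]. Qed.

Lemma supercomm0r a : supercomm a 0 = 0.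
Proof.
by rewrite (supercomm_sign a (graded0 hG false)) mulr0 mul0r subr0.
Qed.

Lemma supercomm0l b : supercomm 0 b = 0.
Proof.
rewrite (part_sum b) supercommDr (supercomm_sign 0 (partG false b)).
by rewrite (supercomm_sign 0 (partG true b)) /= raddf0 !mul0r !mulr0 subrr addr0.
Qed.

Hypothesis supercomm_base : forall k l a b, (k + l <= 1)%N ->
  filt k a -> filt l b -> supercomm a b = 0.

(** With the shift in [filt_pred], the index [(k + l).-1] stands for weight [k + l - 2]; truncation
    sends totals 0 and 1 alike to zero. Above these, [ad_supercomm] lowers the total by one. *)
Lemma filt_supercomm k l a b : filt k a -> filt l b ->
  filt_pred (k + l).-1 (supercomm a b).
Proof.
move: {2}(k + l)%N (erefl (k + l)%N) => n.
elim: n k l a b => [|n IH] k l a b klE fa fb; rewrite klE /=.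
  by apply: (@supercomm_base k l) => //; rewrite klE.
case: n IH klE => [|n] IH klE.
  by apply: (@supercomm_base k l) => //; rewrite klE.
(* The Jacobi identity requires a homogeneous second argument; the general case adds the two parts
   of [b]. *)
have homog j b' : G j b' -> filt l b' -> filt n (supercomm a b').
  move=> Gb' fb'; apply/filt_predE => g Gg.
  rewrite (ad_supercomm a (gens_odd Gg) Gb'); apply: filt_predD.
    case: l klE fb' {fb} => [|l] klE fb'.
      by rewrite fb'// supercomm0r; exact: filt_pred0.
    have kn : (k + l)%N = n.+1 by apply: succn_inj; rewrite -klE addnS.
    by have := IH _ _ _ _ kn fa (filtS_ad fb' Gg); rewrite kn.
  have : filt_pred n (supercomm (ad g a) b').
    case: k klE fa => [|k] klE fa.
      by rewrite fa// supercomm0l; exact: filt_pred0.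
    have kn : (k + l)%N = n.+1 by apply: succn_inj; rewrite -klE addSn.
    by have := IH _ _ _ _ kn (filtS_ad fa Gg) fb'; rewrite kn.
  by case: j {Gb'}; rewrite ?mulN1r ?mul1r//; exact: filt_predN.
rewrite (part_sum b) supercommDr; apply: filtD.
- by apply: (homog false); [exact: partG|exact: filt_part].
- by apply: (homog true); [exact: partG|exact: filt_part].
Qed.

End GradedRing.

(** * The algebra of differential operators *)

Section DiffopRing.
Variables (R : realType) (M : manifold R) (S : complex_bundle M).
Local Notation op := (Gamma(S) -> Gamma(S)).
Local Notation fn := (smoothf M (complex_scalars R)).
Implicit Types (D : op) (f : fn) (s t : Gamma(S)).

Let additive_op D := forall s t, D (s + t) = D s + D t.

Let additive0 D : additive_op D -> D 0 = 0.
Proof. by move=> aD; apply: (addrI (D 0)); rewrite -aD !addr0. Qed.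

Let additiveN D s : additive_op D -> D (- s) = - D s.
Proof.
by move=> aD; apply: (addrI (D s)); rewrite -aD !subrr additive0.
Qed.

Let order0 k : diffop_order k (0 : op).
Proof.
elim: k => [|k IH] f /=; first by apply/funext => s; rewrite scaler0 subr0.
by rewrite (_ : (fun _ => _) = 0) //; apply/funext => s; rewrite scaler0 subr0.
Qed.

Let orderB k D D' : diffop_order k D -> diffop_order k D' -> diffop_order k (D - D').
Proof.
elim: k D D' => [|k IH] D D' oD oD' f /=; last first.
  rewrite (_ : (fun _ => _) = (fun s => D (f *: s) - f *: D s) -
      (fun s => D' (f *: s) - f *: D' s)).
    by apply: IH; [exact: oD|exact: oD'].
  by apply/funext => s; rewrite !fctE /= scalerBr !opprB !addrA [LHS](ACl (1*4*3*2)%AC).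
apply/funext => s; have := congr1 (@^~ s) (oD f); have := congr1 (@^~ s) (oD' f).
rewrite /= !fctE scalerBr => /subr0_eq -> /subr0_eq ->.
by rewrite subrr.
Qed.

Let orderW k D : diffop_order k D -> diffop_order k.+1 D.
Proof.
elim: k D => [|k IH] D oD f; last exact/IH/oD.
exact: (eq_ind_r (diffop_order 0) (order0 0) (oD f)).
Qed.

Let orderWn k m D : (k <= m)%N -> diffop_order k D -> diffop_order m D.
Proof.
move=> /subnK <-; elim: (m - k)%N => [//|n IH] oD.
by rewrite addSn; exact/orderW/IH.
Qed.

(** The commutator with a function is a derivation for composition, so induction on [k + l] works.
    Additivity is carried along because it passes to commutators. *)
Let order_comp k l D D' : additive_op D -> diffop_order k D -> diffop_order l D' ->
  diffop_order (k + l) (D \o D').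
Proof.
have orderD m D1 D2 : diffop_order m D1 -> diffop_order m D2 ->
    diffop_order m (D1 + D2).
  move=> o1 o2; rewrite -(opprK D2); apply: orderB => //.
  by rewrite -sub0r; exact: orderB.
have commE D1 D2 f : additive_op D1 ->
    (fun s => D1 (D2 (f *: s)) - f *: D1 (D2 s)) =
    (D1 \o (fun s => D2 (f *: s) - f *: D2 s)) +
    ((fun s => D1 (f *: s) - f *: D1 s) \o D2).
  move=> aD1; apply/funext => s.
  by rewrite !fctE /= aD1 (additiveN _ aD1) addrA subrK.
have commA D1 f : additive_op D1 -> additive_op (fun s => D1 (f *: s) - f *: D1 s).
  by move=> aD1 s t; rewrite scalerDr !aD1 scalerDr opprD addrACA.
move: {2}(k + l)%N (erefl (k + l)%N) => n.
elim: n k l D D' => [|n IH] k l D D' klE aD oD oD'; rewrite klE => f /=;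
    rewrite commE//.
  move: klE oD oD' => /eqP; rewrite addn_eq0 => /andP[/eqP-> /eqP->] oD oD'.
  rewrite (oD f) (oD' f); apply/funext => s.
  by rewrite !fctE /= (additive0 aD) addr0.
apply: orderD.
- case: l klE oD' => [|l] klE oD'.
    rewrite (oD' f) (_ : _ \o _ = 0); first exact: order0.
    by apply/funext => s; rewrite !fctE /= additive0.
  have kln : n = (k + l)%N by apply: succn_inj; rewrite -klE addnS.
  by rewrite kln; exact: IH (esym kln) aD oD (oD' f).
- case: k klE oD => [|k] klE oD.
    by rewrite (oD f); exact: order0.
  have kln : n = (k + l)%N by apply: succn_inj; rewrite -klE addSn.
  by rewrite kln; exact: IH (esym kln) (commA _ _ aD) (oD f) oD'.
Qed.

Definition diffop_pred : {pred op} := fun D => `[< diffop S D >].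

Fact diffop_zmod_closed : zmod_closed diffop_pred.
Proof.
split=> [|D D'].
  apply/asboolP; split; last by exists 0%N; exact: order0.
  by split=> [s t|c s]; rewrite /= ?addr0 ?scaler0.
move=> /asboolP[[aD sD] [k oD]] /asboolP[[aD' sD'] [l oD']]; apply/asboolP.
split; last first.
  by exists (maxn k l); apply: orderB; [apply: orderWn oD|apply: orderWn oD'];
    rewrite ?leq_maxl ?leq_maxr.
split=> [s t|c s]; rewrite !fctE /=; first by rewrite aD aD' opprD addrACA.
by rewrite sD sD' scalerBr.
Qed.

Fact diffop_id : diffop S id.
Proof.
split; first by split.
by exists 0%N => f; apply/funext => s; rewrite subrr.
Qed.

Fact diffop_scale f : diffop S (fun s => f *: s).
Proof.
split; first by split=> [s t|c s]; rewrite ?scalerDr// !scalerA mulrC.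
by exists 0%N => h; apply/funext => s; rewrite !scalerA mulrC subrr.
Qed.

Fact diffop_comp D D' : diffop S D -> diffop S D' -> diffop S (D \o D').
Proof.
move=> [[aD sD] [k oD]] [[aD' sD'] [l oD']]; split; last first.
  by exists (k + l)%N; exact: order_comp.
by split=> [s t|c s] /=; rewrite ?aD' ?aD ?sD' ?sD.
Qed.

(** Bundled to form a ring under composition: [A * (B + C) = A * B + A * C] uses the additivity of
    [A]. *)
Record dop := Dop { dop_fun :> op; _ : dop_fun \in diffop_pred }.
HB.instance Definition _ := [isSub for dop_fun].
HB.instance Definition _ := [Choice of dop by <:].
HB.instance Definition _ := GRing.SubChoice_isSubZmodule.Build op diffop_pred
  dop diffop_zmod_closed.

Definition mk_dop D (dD : diffop S D) : dop := Dop (introT (asboolP _) dD).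

Lemma dopP (A : dop) : diffop S A.
Proof. by case: A => D dD; exact/asboolP. Qed.

Lemma dop_eq (A B : dop) : (forall s, A s = B s) -> A = B.
Proof. by move=> AB; apply: val_inj; apply/funext. Qed.

Lemma dopDr (A : dop) s t : A (s + t) = A s + A t.
Proof. by case: (dopP A) => -[]. Qed.

Lemma dop0r (A : dop) : A 0 = 0.
Proof. exact/additive0/dopDr. Qed.

Lemma dop_cst (A : dop) (c : R[i]) s :
  A (smoothf_cst M (c : complex_scalars R) *: s) =
  smoothf_cst M (c : complex_scalars R) *: A s.
Proof. by case: (dopP A) => -[]. Qed.

Definition dop_mul (A B : dop) := mk_dop (diffop_comp (dopP A) (dopP B)).

Fact dop_mulA : associative dop_mul. Proof. by move=> A B C; exact: dop_eq. Qed.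
Fact dop_mul1 : left_id (mk_dop diffop_id) dop_mul.
Proof. by move=> A; exact: dop_eq. Qed.
Fact dop_mulr1 : right_id (mk_dop diffop_id) dop_mul.
Proof. by move=> A; exact: dop_eq. Qed.
Fact dop_mulDl : left_distributive dop_mul +%R.
Proof. by move=> A B C; exact: dop_eq. Qed.
Fact dop_mulDr : right_distributive dop_mul +%R.
Proof. by move=> A B C; apply: dop_eq => s; exact: dopDr. Qed.

HB.instance Definition _ := GRing.Zmodule_isPzRing.Build dop
  dop_mulA dop_mul1 dop_mulr1 dop_mulDl dop_mulDr.

Lemma dopD (A B : dop) s : (A + B) s = A s + B s. Proof. by []. Qed.
Lemma dopM (A B : dop) s : (A * B) s = A (B s). Proof. by []. Qed.

Lemma dop_sumE (I : Type) (r : seq I) (A : I -> dop) s :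
  (\sum_(i <- r) A i) s = \sum_(i <- r) A i s.
Proof. by elim/big_rec2 : _ => // i y1 y2 _ <-. Qed.

Definition dop_scale f : dop := mk_dop (diffop_scale f).

Lemma dop_scaleE f s : dop_scale f s = f *: s. Proof. by []. Qed.

Lemma dop_scaleM f h : dop_scale (f * h) = dop_scale f * dop_scale h.
Proof. by apply: dop_eq => s; rewrite dopM !dop_scaleE scalerA. Qed.

Lemma dop_scaleD f h : dop_scale (f + h) = dop_scale f + dop_scale h.
Proof. by apply: dop_eq => s; rewrite dopD !dop_scaleE scalerDl. Qed.

Lemma dop_scaleC f h : dop_scale f * dop_scale h = dop_scale h * dop_scale f.
Proof. by rewrite -!dop_scaleM mulrC. Qed.

Definition dop_comm (A : dop) f : dop := A * dop_scale f - dop_scale f * A.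

Fixpoint order_le k (A : dop) : Prop := forall f,
  if k is k'.+1 then order_le k' (dop_comm A f) else dop_comm A f = 0.

Lemma order_leP k (A : dop) : diffop_order k A <-> order_le k A.
Proof.
elim: k A => [|k IH] A; split=> oA f.
- by apply: val_inj; exact: oA.
- exact: (congr1 val (oA f)).
- exact/IH/oA.
- exact: (proj2 (IH (dop_comm A f)) (oA f)).
Qed.

Lemma dop_order (A : dop) : exists k, order_le k A.
Proof. by have [_ [k /order_leP]] := dopP A; exists k. Qed.

Definition tensorial (A : dop) := forall f, A * dop_scale f = dop_scale f * A.

Lemma tensorialP (A : dop) : tensorial A <-> order_le 0 A.
Proof.
by split=> [tA f|oA f]; [rewrite /dop_comm tA subrr|apply: subr0_eq; exact: oA].
Qed.

(** Write [r *: s] in a global frame: [A] passes through the coefficients, which vanish at [x], and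
    [r x] is nonzero. *)
Lemma tensorial_local (A : dop) s x : tensorial A -> s x = 0 -> A s x = 0.
Proof.
move=> tA sx; have [r [e [c [rx re c0]]]] := global_frame S x.
have tA' f t : A (f *: t) = f *: A t.
  by rewrite -!dop_scaleE -!dopM tA.
have : (r *: A s) x = 0.
  rewrite -tA' re (big_morph A (dopDr A) (dop0r A)) section_sumE.
  by rewrite big1// => i _; rewrite tA' /= c0// scale0r.
by move=> /= /eqP; rewrite scaler_eq0 (negbTE rx) => /eqP.
Qed.

(** The endomorphism applies [A] to any section extending a given vector; [tensorial_local] makes
    the choice immaterial. *)
Lemma tensorial_fibre (A : dop) x : tensorial A ->
  exists h : 'End(S x), forall s, A s x = h (s x).
Proof.
move=> tA.
have loc s t : s x = t x -> A s x = A t x.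
  move=> st; have aD := dopDr A; apply: subr0_eq; rewrite -(subrK t s).
  rewrite dopDr /= addrK; apply: tensorial_local => //=.
  by rewrite st subrr.
have /choice[ext extE] : forall v : S x, exists s : Gamma(S), s x = v.
  exact: section_extend.
pose h v := A (ext v) x.
have hl : linear h.
  move=> c u v; rewrite /h -[RHS]/((smoothf_cst M c *: A (ext u) + A (ext v)) x).
  rewrite -dop_cst -dopDr; apply: loc.
  by rewrite extE /= !extE.
pose H : {linear S x -> S x} := HB.pack h (GRing.isLinear.Build _ _ _ _ h hl).
exists (linfun H) => s; rewrite lfunE; apply: loc.
by rewrite extE.
Qed.

End DiffopRing.

(** * Clifford algebras *)

Section RingIdentities.
Variable A : pzRingType.
Implicit Types x y a : A.

Lemma mulrDD x0 x1 y0 y1 : (x0 + x1) * (y0 + y1) =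
  (x0 * y0 + x1 * y1) + (x0 * y1 + x1 * y0) :> A.
Proof. ncring. Qed.

Lemma anticomm_odd_part x a0 a1 : x * (a0 + a1) + (a0 + a1) * x = 0 ->
  x * (a0 - a1) + (a0 - a1) * x = 0 ->
  (x * a1 + a1 * x) + (x * a1 + a1 * x) = 0.
Proof. by move=> e1 e2; rewrite -(subrr 0) -[X in X - _]e1 -[X in _ - X]e2; ncring. Qed.

End RingIdentities.

Section CliffordParity.
Variables (R : realType) (V : lmodType R) (b : V -> V -> R).
Local Notation Cl := (clifford b).
Local Notation gen := (cl_gen b).
Local Notation cst := (cl_cst b).
Implicit Types (x y a : Cl) (v : V).

Lemma cl_cst_add c d : cst (c + d) = cst c + cst d.
Proof. by rewrite /cl_cst (clpiE (cl_cstD _ _ _)) clpiD. Qed.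

Lemma cl_cst_mul c d : cst (c * d) = cst c * cst d.
Proof. by rewrite /cl_cst (clpiE (cl_cstM _ _ _)) clpiM. Qed.

Lemma cl_scaleE c x : c *: x = cst c * x. Proof. by []. Qed.

Lemma cl_cst_comm c x : cst c * x = x * cst c.
Proof. exact: clifford_cstC. Qed.

Lemma cl_cstE c : cst c = c *: (1 : Cl). Proof. by rewrite cl_scaleE mulr1. Qed.

Lemma cl_scaleAr c x y : x * (c *: y) = c *: (x * y).
Proof. by rewrite !cl_scaleE !mulrA cl_cst_comm. Qed.

Lemma cl_scaleAl c x y : (c *: x) * y = c *: (x * y).
Proof. by rewrite !cl_scaleE mulrA. Qed.

Lemma cl_gen_lin c u v : gen (c *: u + v) = c%:C%C *: gen u + gen v.
Proof. by rewrite /cl_gen (clpiE (cl_gen_linear _ _ _ _)) clpiD clpiM. Qed.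

Lemma cl_genD u v : gen (u + v) = gen u + gen v.
Proof. by rewrite -[u in LHS]scale1r cl_gen_lin scale1r. Qed.

Lemma cl_gen0 : gen 0 = 0.
Proof. by apply: (addrI (gen 0)); rewrite -cl_genD !addr0. Qed.

Lemma cl_genZ c u : gen (c *: u) = c%:C%C *: gen u.
Proof. by rewrite -[c *: u]addr0 cl_gen_lin cl_gen0 addr0. Qed.

Lemma clifford_induction (Q : Cl -> Prop) : (forall v, Q (gen v)) ->
  (forall c, Q (cst c)) -> (forall x y, Q x -> Q y -> Q (x + y)) ->
  (forall x y, Q x -> Q y -> Q (x * y)) -> forall x, Q x.
Proof.
move=> Qg Qc QD QM; elim/clifford_ind; elim=> [v|c|x Qx y Qy|x Qx y Qy].
- exact: Qg.
- exact: Qc.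
- by rewrite clpiD; exact: QD.
- by rewrite clpiM; exact: QM.
Qed.

Lemma clifford_part0 i : clifford_part i (0 : Cl).
Proof. by exists [::]; rewrite big_nil. Qed.

Lemma clifford_partD i x y :
  clifford_part i x -> clifford_part i y -> clifford_part i (x + y).
Proof.
by move=> [s [si ->]] [t [ti ->]]; exists (s ++ t); rewrite all_cat si ti big_cat.
Qed.

Lemma clifford_part_word i c w : odd (size w) = i ->
  clifford_part i (c *: \prod_(v <- w) gen v : Cl).
Proof.
by move=> wi; exists [:: (c, w)]; rewrite /= wi eqxx big_seq1.
Qed.

Lemma clifford_part_ind i (Q : Cl -> Prop) : Q 0 ->
  (forall x y, Q x -> Q y -> Q (x + y)) ->
  (forall c w, odd (size w) = i -> Q (c *: \prod_(v <- w) gen v)) ->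
  forall x, clifford_part i x -> Q x.
Proof.
move=> Q0 QD Qw _ [s [si ->]]; rewrite big_seq; elim/big_ind: _ => //.
by move=> p /(allP si) /eqP; exact: Qw.
Qed.

Lemma clifford_partM i j x y : clifford_part i x -> clifford_part j y ->
  clifford_part (i (+) j) (x * y).
Proof.
move=> xi yj; elim/clifford_part_ind: xi => [|x1 x2 IH1 IH2|c w wi].
- by rewrite mul0r; exact: clifford_part0.
- by rewrite mulrDl; exact: clifford_partD.
elim/clifford_part_ind: yj => [|y1 y2 IH1 IH2|d u uj].
- by rewrite mulr0; exact: clifford_part0.
- by rewrite mulrDr; exact: clifford_partD.
rewrite cl_scaleAl cl_scaleAr scalerA -big_cat; apply: clifford_part_word.
by rewrite size_cat oddD wi uj.
Qed.

Lemma clifford_part_sum x : exists x0 x1,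
  [/\ clifford_part false x0, clifford_part true x1 & x = x0 + x1].
Proof.
elim/clifford_induction: x => [v|c|x y|x y].
- exists 0, (gen v); split; rewrite ?add0r//; first exact: clifford_part0.
  by exists [:: (1, [:: v])]; rewrite !big_seq1 scale1r.
- exists (cst c), 0; split; rewrite ?addr0//; last exact: clifford_part0.
  by exists [:: (c, [::])]; rewrite big_seq1 big_nil cl_cstE.
- move=> [x0 [x1 [X0 X1 ->]]] [y0 [y1 [Y0 Y1 ->]]].
  exists (x0 + y0), (x1 + y1).
  by split; [exact: clifford_partD|exact: clifford_partD|exact: addrACA].
- move=> [x0 [x1 [X0 X1 ->]]] [y0 [y1 [Y0 Y1 ->]]].
  exists (x0 * y0 + x1 * y1), (x0 * y1 + x1 * y0).
  split; last exact: mulrDD.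
  + exact: clifford_partD (clifford_partM X0 Y0) (clifford_partM X1 Y1).
  + exact: clifford_partD (clifford_partM X0 Y1) (clifford_partM X1 Y0).
Qed.

(** * The grading automorphism of the Clifford algebra *)

Fixpoint cl_flip (t : cl_term V) : Cl :=
  match t with
  | CGen v => - gen v
  | CCst c => cst c
  | CAdd x y => cl_flip x + cl_flip y
  | CMul x y => cl_flip x * cl_flip y
  end.

(** Generators occur in only two specific relations: linearity, homogeneous of degree one, and the
    Clifford relation, quadratic on its left side. Both survive the sign change. *)
Lemma cl_flip_eq s t : cl_eq b s t -> cl_flip s = cl_flip t.
Proof.
elim=> {s t} /=.
- by [].
- by move=> ? ? _ ->.
- by move=> ? ? ? _ -> _ ->.
- by move=> ? ? ? ? _ -> _ ->.
- by move=> ? ? ? ? _ -> _ ->.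
- by move=> *; exact: addrA.
- by move=> *; exact: addrC.
- by move=> *; exact: add0r.
- by move=> x; exact: clifford_addN.
- by move=> *; exact: mulrA.
- by move=> *; exact: mul1r.
- by move=> *; exact: mulrDl.
- by move=> *; exact: mulrDr.
- by move=> *; exact: cl_cst_add.
- by move=> *; exact: cl_cst_mul.
- by move=> *; exact: cl_cst_comm.
- by move=> c u v; rewrite cl_gen_lin opprD mulrN.
- by move=> u v; rewrite !mulrNN cl_gen_rel cl_cstE.
Qed.

Definition cl_aut x : Cl := cl_flip (repr x).

Lemma cl_aut_pi t : cl_aut (clpi b t) = cl_flip t.
Proof. exact/cl_flip_eq/clpi_repr. Qed.

Lemma cl_autD x y : cl_aut (x + y) = cl_aut x + cl_aut y.
Proof.
elim/clifford_ind: x => s; elim/clifford_ind: y => t.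
by rewrite -[_ + _]clpiD !cl_aut_pi.
Qed.

Lemma cl_autM x y : cl_aut (x * y) = cl_aut x * cl_aut y.
Proof.
elim/clifford_ind: x => s; elim/clifford_ind: y => t.
by rewrite -[_ * _]clpiM !cl_aut_pi.
Qed.

Lemma cl_aut_gen v : cl_aut (gen v) = - gen v. Proof. exact: cl_aut_pi. Qed.
Lemma cl_aut_cst c : cl_aut (cst c) = cst c. Proof. exact: cl_aut_pi. Qed.

Lemma cl_aut_part i x : clifford_part i x -> cl_aut x = (-1) ^+ i * x.
Proof.
have aut0 : cl_aut 0 = 0 by exact: (cl_aut_cst 0).
elim/clifford_part_ind => [|y z IHy IHz|c w <-]; first by rewrite aut0 mulr0.
  by rewrite cl_autD IHy IHz mulrDr.
rewrite signr_odd !cl_scaleE cl_autM cl_aut_cst mulrA -commr_sign -mulrA; congr (_ * _).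
elim: w => [|v w IHw] /=; first by rewrite big_nil expr0 mul1r; exact: (cl_aut_cst 1).
rewrite !big_cons cl_autM cl_aut_gen IHw exprS mulrA mulN1r.
by rewrite [in RHS]mulNr !mulNr commr_sign mulrA.
Qed.

Lemma clifford_two_torsion_free x : x + x = 0 -> x = 0.
Proof.
move=> xx; have : (2 : R[i]) *: x = 0 by rewrite scalerDl scale1r.
move=> /(congr1 ( *:%R 2^-1)); rewrite scaler0 scalerA mulVf ?scale1r//.
by rewrite pnatr_eq0.
Qed.

Lemma gen_comm_central a : (forall v, gen v * a = a * gen v) ->
  forall x, x * a = a * x.
Proof.
move=> ga; apply: clifford_induction => // [c|x y IHx IHy|x y IHx IHy].
- exact: cl_cst_comm.
- by rewrite mulrDl mulrDr IHx IHy.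
- by rewrite -mulrA IHy mulrA IHx mulrA.
Qed.

(** Each letter of a word contributes one sign when moved past [a]. *)
Lemma gen_anticomm_part a i x : (forall v, gen v * a = - (a * gen v)) ->
  clifford_part i x -> x * a = (-1) ^+ i * (a * x).
Proof.
move=> ga; elim/clifford_part_ind => [|y z IHy IHz|c w <-].
- by rewrite mul0r !mulr0.
- by rewrite mulrDl IHy IHz -!mulrDr.
rewrite signr_odd cl_scaleAl !cl_scaleAr; congr (_ *: _).
elim: w => [|v w IHw]; first by rewrite big_nil expr0 mulr1.
rewrite big_cons -mulrA IHw /= mulrA commr_sign -mulrA exprSr -[RHS]mulrA.
by congr (_ * _); rewrite mulN1r mulrA ga mulNr mulrA.
Qed.

(* The odd part [a1] of [a] anticommutes with the generators too, hence with odd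
   elements, itself included; so [a1 * x * a1] is a multiple of [a1 * a1 = 0]. *)
Lemma gen_anticomm_even a : (forall y, (forall x, y * x * y = 0) -> y = 0) ->
  (forall v, gen v * a = - (a * gen v)) -> clifford_part false a.
Proof.
move=> prime ga; have [a0 [a1 [A0 A1 aE]]] := clifford_part_sum a.
suff -> : a = a0 by [].
have ga1 v : gen v * a1 = - (a1 * gen v).
  apply/eqP; rewrite -addr_eq0; apply/eqP; apply: clifford_two_torsion_free.
  have e1 : gen v * a + a * gen v = 0 by rewrite ga addNr.
  apply: (anticomm_odd_part (a0 := a0)); first by rewrite -aE.
  (* Up to sign, the automorphism turns the relation for [a0 + a1] into the one for [a0 - a1]; their
     difference is twice the relation for [a1]. *)
  have : cl_aut (gen v * a + a * gen v) = 0 by rewrite e1; exact: (cl_aut_cst 0).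
  rewrite cl_autD !cl_autM cl_aut_gen aE cl_autD (cl_aut_part A0) (cl_aut_part A1).
  rewrite expr0 expr1 mul1r mulN1r mulNr mulrN -opprD => /eqP.
  by rewrite oppr_eq0 => /eqP.
have a11 : a1 * a1 = 0.
  apply: clifford_two_torsion_free.
  by rewrite {1}(gen_anticomm_part ga1 A1) expr1 mulN1r addNr.
suff a10 : a1 = 0 by rewrite aE a10 addr0.
apply: prime => x; have [x0 [x1 [X0 X1 ->]]] := clifford_part_sum x.
rewrite -mulrA mulrDl (gen_anticomm_part ga1 X0) (gen_anticomm_part ga1 X1) mulN1r mul1r.
by rewrite mulrBr !mulrA a11 !mul0r subrr.
Qed.

End CliffordParity.

(** * The spinor filtration *)

Section EndAlgebra.
Variables (K : fieldType) (V : vectType K).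

Lemma lfun_onto (u w : V) : u != 0 -> exists f : 'End(V), f u = w.
Proof.
move=> u0; pose f v := coord [tuple u] ord0 v *: w.
have fl : linear f.
  by move=> c v v'; rewrite /f linearP scalerDl scalerA.
pose F : {linear V -> V} := HB.pack f (GRing.isLinear.Build _ _ _ _ f fl).
exists (linfun F); rewrite lfunE /= /f.
have := coord_free ord0 ord0 (X := [tuple u]); rewrite seq1_free u0 => /(_ isT).
by rewrite /= => ->; rewrite scale1r.
Qed.

(** If [h v] is nonzero, some [f] sends it back to [v], and then [h \o f \o h] maps [v] to [h v].
    Transported along [spinor_iso], this is the primeness assumed in [gen_anticomm_even]. *)
Lemma lfun_prime (h : 'End(V)) : (forall f : 'End(V), (h \o f \o h)%VF = 0) -> h = 0.
Proof.
move=> hfh; apply/lfunP => v; rewrite zero_lfunE; apply/eqP/negPn/negP => hv.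
have [f fhv] := lfun_onto v hv.
have := congr1 (fun k : 'End(V) => k v) (hfh f).
by rewrite !comp_lfunE /= fhv zero_lfunE => /eqP; rewrite (negbTE hv).
Qed.

End EndAlgebra.

Section SpinorFiltration.
Variables (R : realType) (M : manifold R) (E : real_bundle M).
Variables (g : fibre_metric E) (S : spinor_bundle g).
Variable P : bool -> set (Gamma(S) -> Gamma(S)).
Hypothesis hP : spinor_grading P.
Local Notation op := (Gamma(S) -> Gamma(S)).
Local Notation gammaS := (@gamma R M E g S).
Local Notation iso := (spinor_iso S).
Implicit Types (A B : dop S) (xi eta : Gamma(E)) (s : Gamma(S)) (x : M).

Lemma isoD x a b : iso (a + b) = iso a + iso b :> 'End(S x).
Proof. by rewrite -[a in LHS]scale1r spinor_iso_linear scale1r. Qed.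

Lemma iso0 x : iso 0 = 0 :> 'End(S x).
Proof. by apply: (addrI (iso 0)); rewrite -isoD !addr0. Qed.

Lemma isoZ x (c : R[i]) a : iso (c *: a) = c *: iso a :> 'End(S x).
Proof. by rewrite -[c *: a]addr0 spinor_iso_linear iso0 addr0. Qed.

Lemma iso_scalar x (c : R[i]) (v : S x) : iso (c *: (1 : clifford (g x))) v = c *: v.
Proof. by rewrite isoZ spinor_iso_one scale_lfunE id_lfunE. Qed.

Lemma isoM x a b (v : S x) : iso (a * b) v = iso a (iso b v).
Proof. by rewrite spinor_iso_mul comp_lfunE. Qed.

Definition dop_part (i : bool) : set (dop S) := [set A | P i (val A)].

Lemma P_sub i D D' : P i D -> P i D' -> P i (D - D').
Proof.
move=> PD PD'; have [_ Padd Pscale] := grading_subspace hP i.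
apply: Padd => //; have := Pscale (-1) _ PD'; congr (P i _).
by apply/funext => s; apply: section_eq => x /=; rewrite scaleN1r.
Qed.

Definition P_dop i D (PD : P i D) : dop S := mk_dop (grading_sub hP PD).

Lemma dop_graded : graded_ring dop_part.
Proof.
split.
- by move=> i; have [P0 _ _] := grading_subspace hP i.
- by move=> i A B; exact: P_sub.
- by move=> i j A B; exact: (grading_mul hP).
- move=> A; have [D0 [D1 [P0 P1 AE]]] := grading_sum hP (dopP A).
  by exists (P_dop P0), (P_dop P1); split=> //; exact: val_inj.
- by move=> A P0 P1; apply: val_inj; apply: (grading_direct hP).
Qed.

Local Notation hG := dop_graded.
Local Notation dpart := (part dop_part).
Local Notation dparity := (parity dop_part).
Local Notation dsupercomm := (supercomm dop_part).

Lemma hpart_val i A : hpart P i (val A) = val (dpart i A).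
Proof.
have [Pp Pn] := part_spec hG i A.
rewrite /hpart; case: xgetP => [D _ [PD PnD]|/(_ (val (dpart i A)))]; last by case.
by rewrite (@partE _ _ hG i A (P_dop PD)).
Qed.

Lemma gcomm_val A B : gcomm P (val A) (val B) = val (dsupercomm A B).
Proof.
rewrite /gcomm /supercomm !big_bool /= !hpart_val.
by rewrite expr0 expr1 !mulr1z !mulrN1z.
Qed.

Lemma gamma_odd xi : P true (gammaS xi).
Proof.
apply: (grading_clifford hP); exists (fun x => cl_gen _ (xi x)); split=> // x.
by exists [:: (1, [:: xi x])]; rewrite !big_seq1 scale1r.
Qed.

Definition gam xi : dop S := P_dop (gamma_odd xi).

Lemma gam_odd xi : dop_part true (gam xi). Proof. exact: gamma_odd. Qed.

Lemma gamE xi s x : gam xi s x = iso (cl_gen _ (xi x)) (s x). Proof. by []. Qed.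

(** A function acts as a multiple of the empty word, which has even length. *)
Lemma scale_even f : dop_part false (dop_scale S f).
Proof.
apply: (grading_clifford hP); exists (fun x => (f x : R[i]) *: (1 : clifford (g x))); split.
- by move=> x; exists [:: (f x : R[i], [::])]; rewrite big_seq1 big_nil.
- by move=> s x; rewrite iso_scalar.
Qed.

Lemma scale_gam f xi : dop_scale S f * gam xi = gam xi * dop_scale S f.
Proof.
apply: dop_eq => s; apply: section_eq => x.
by rewrite !dopM /= linearZ.
Qed.

Lemma gam_rel xi eta : gam xi * gam eta + gam eta * gam xi =
  dop_scale S (smoothf_of_real (metric_section g xi eta)).
Proof.
apply: dop_eq => s; apply: section_eq => x.
rewrite dopD !dopM -[LHS]/(gam xi (gam eta s) x + gam eta (gam xi s) x).
by rewrite !gamE -!isoM -add_lfunE -isoD cl_gen_rel iso_scalar.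
Qed.

Lemma gamD xi eta : gam (xi + eta) = gam xi + gam eta.
Proof.
apply: dop_eq => s; apply: section_eq => x.
rewrite dopD -[RHS]/(gam xi s x + gam eta s x) !gamE -add_lfunE -isoD.
by rewrite -cl_genD.
Qed.

Lemma gamZ (f : C^oo(M)) xi :
  gam (f *: xi) = dop_scale S (smoothf_of_real f) * gam xi.
Proof.
apply: dop_eq => s; apply: section_eq => x.
rewrite dopM -[RHS]/((f x)%:C%C *: gam xi s x) !gamE -scale_lfunE -isoZ.
by rewrite -cl_genZ.
Qed.

Definition gens : set (dop S) := range gam.

Lemma gens_odd : gens `<=` dop_part true.
Proof. by move=> _ [xi _ <-]; exact: gam_odd. Qed.

Local Notation dfilt := (filt dop_part gens).
Local Notation adg xi := (ad dop_part (gam xi)).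

(** As [gamma xi] is odd, its graded commutator is [ad]; this transfers the filtration to the
    superalgebra [dop S]. *)
Lemma spin_filtration_val k A : spin_filtration P k%:Z (val A) <-> dfilt k A.
Proof.
have e B xi : gcomm P (val B) (gammaS xi) = val (adg xi B).
  by rewrite -[gammaS xi]/(val (gam xi)) gcomm_val (supercomm_odd hG)//; exact: gam_odd.
rewrite /spin_filtration; elim: k A => [|k IH] A; split.
- by move=> [_ fA] _ [xi _ <-]; apply: val_inj; exact: etrans (esym (e _ _)) (fA _).
- by move=> fA; split; [exact: dopP|move=> xi; rewrite e fA//; exists xi].
- by move=> [_ fA] _ [xi _ <-]; apply/IH; rewrite -e; exact: fA.
- move=> fA; split; [exact: dopP|move=> xi; rewrite e; apply/IH].
  by apply: fA; exists xi.
Qed.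

Lemma spin_filtration_diffop k D : spin_filtration P k%:Z D -> diffop S D.
Proof. by case: k => [|k] []. Qed.

Lemma spin_filtration_ex k D : spin_filtration P k%:Z D ->
  exists2 A : dop S, D = val A & dfilt k A.
Proof.
move=> fD; exists (mk_dop (spin_filtration_diffop fD)) => //.
by apply/spin_filtration_val.
Qed.

Lemma filt_scale f : dfilt 0 (dop_scale S f).
Proof.
move=> _ [xi _ <-]; rewrite /ad (parity_even hG (scale_even f)).
by rewrite scale_gam subrr.
Qed.

(** * Iterated supercommutators and exhaustion *)

Lemma ad_comm xi A f : adg xi (dop_comm A f) = dop_comm (adg xi A) f.
Proof.
exact: ad_comm_even hG _ _ _ (scale_even f) (scale_gam f xi).
Qed.

Lemma ad_tensorial xi A : tensorial A -> tensorial (adg xi A).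
Proof.
move=> /tensorialP tA; apply/tensorialP => f.
by rewrite -ad_comm tA (ad0 hG).
Qed.

Lemma ad_scale xi f A : adg xi (dop_scale S f * A) = dop_scale S f * adg xi A.
Proof.
rewrite (adM hG) (_ : adg xi (dop_scale S f) = 0) ?mul0r ?addr0//.
by apply: filt_scale; exists xi.
Qed.

(** In the term [A * gam (f *: xi)] the function has to pass [A], which is what tensoriality
    permits. *)
Lemma adZ xi (f : C^oo(M)) A : tensorial A ->
  adg (f *: xi) A = dop_scale S (smoothf_of_real f) * adg xi A.
Proof.
by move=> tA; rewrite /ad gamZ mulrA tA mulrBr !mulrA.
Qed.

Lemma adDgen xi eta A : adg (xi + eta) A = adg xi A + adg eta A.
Proof. by rewrite gamD; exact: ad_genD. Qed.

Lemma ad_sumgen (I : Type) (r : seq I) (F : I -> Gamma(E)) A :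
  adg (\sum_(i <- r) F i) A = \sum_(i <- r) adg (F i) A.
Proof.
apply: (big_morph (fun xi => adg xi A)) => [xi eta|]; first exact: adDgen.
by apply: (addrI (adg 0 A)); rewrite -adDgen !addr0.
Qed.

Lemma ad_anti xi eta A : tensorial A -> adg xi (adg eta A) = - adg eta (adg xi A).
Proof.
move=> tA; apply/eqP; rewrite -addr_eq0; apply/eqP.
rewrite (ad_anticomm hG); [|exact: gam_odd|exact: gam_odd].
by rewrite gam_rel tA subrr.
Qed.

Lemma dop_two_torsion_free A : A + A = 0 -> A = 0.
Proof.
move=> AA; apply: dop_eq => s; apply: section_eq => x.
have : (A + A) s x = 0 by rewrite AA.
rewrite -[LHS]/(A s x + A s x) => e.
have : (2 : complex_scalars R) *: A s x = 0 by rewrite scalerDl scale1r.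
by move=> /eqP; rewrite scaler_eq0 pnatr_eq0 => /eqP.
Qed.

Lemma ad_square xi A : tensorial A -> adg xi (adg xi A) = 0.
Proof.
by move=> tA; apply: dop_two_torsion_free; rewrite {1}(ad_anti _ _ tA) addNr.
Qed.

(** The head of the list acts first, as in the recursion of [filt]. *)
Definition ads (L : seq (Gamma(E))) A : dop S := foldl (fun B xi => adg xi B) A L.

Lemma ads0 L : ads L 0 = 0.
Proof. by elim: L => //= xi L IH; rewrite (ad0 hG). Qed.

Lemma adsD L A B : ads L (A + B) = ads L A + ads L B.
Proof. by elim: L A B => //= xi L IH A B; rewrite (adD hG) IH. Qed.

Lemma ads_scale L f A : ads L (dop_scale S f * A) = dop_scale S f * ads L A.
Proof. by elim: L A => //= xi L IH A; rewrite ad_scale IH. Qed.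

Lemma ads_comm L A f : ads L (dop_comm A f) = dop_comm (ads L A) f.
Proof. by elim: L A => //= xi L IH A; rewrite ad_comm IH. Qed.

Lemma filt_ads k A : (forall L, size L = k.+1 -> ads L A = 0) -> dfilt k A.
Proof.
elim: k A => [|k IH] A fA _ [xi _ <-]; first exact: (fA [:: xi]).
by apply: IH => L sL; apply: (fA (xi :: L)); rewrite /= sL.
Qed.

(* Near [x] every section of [E] is a combination of the [e i]. *)
Lemma ads_frame x : exists e : 'I_(vrank E) -> Gamma(E),
  forall L xi A s, tensorial A -> (forall i, ads L (adg (e i) A) s x = 0) ->
    ads (xi :: L) A s x = 0.
Proof.
have [r [e [c [rx re _]]]] := global_frame E x.
exists e => L xi A s tA eA.
have : (dop_scale S (smoothf_of_real r) * ads L (adg xi A)) s x = 0.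
  rewrite -ads_scale -adZ// re ad_sumgen (big_morph (ads L) (adsD L) (ads0 L)).
  rewrite dop_sumE section_sumE big1// => i _; rewrite adZ// ads_scale dopM.
  by rewrite -[LHS]/((c xi i x)%:C%C *: ads L (adg (e i) A) s x) eA scaler0.
rewrite dopM -[LHS]/((r x)%:C%C *: ads (xi :: L) A s x) => /eqP.
by rewrite scaler_eq0 fmorph_eq0 (negbTE rx) => /eqP.
Qed.

(* On tensorial operators [adg] is alternating in the sections of [E], and only
   [vrank E] of them matter near a point. *)
Lemma ads_tensorial A L : tensorial A -> size L = (vrank E).+1 -> ads L A = 0.
Proof.
move=> tA sL; apply: dop_eq => s; apply: section_eq => x.
have [e eP] := ads_frame x.
(* [I] collects the frame indices already applied; they annihilate [B] by the alternating property.
   Each step adds an index, and [n] bounds the number that remain. *)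
suff main n (I : {set 'I_(vrank E)}) L' B : tensorial B -> (#|~: I| <= n)%N ->
    (forall i, i \in I -> adg (e i) B = 0) -> size L' = n.+1 -> ads L' B s x = 0.
  have c0 : (#|~: (finset.set0 : {set 'I_(vrank E)})| <= vrank E)%N.
    by rewrite finset.setC0 cardsT card_ord.
  have k0 i : i \in (finset.set0 : {set 'I_(vrank E)}) -> adg (e i) A = 0 by rewrite inE.
  exact: (main _ _ _ _ tA c0 k0 sL).
elim: n I L' B => [|n IH] I [//|xi L'] B tB cI kI [sL']; apply: eP => // i.
all: have [iI|iI] := boolP (i \in I); first by rewrite kI// ads0.
- have : i \in ~: I by rewrite inE.
  by move: cI; rewrite leqn0 cards_eq0 => /eqP ->; rewrite inE.
- apply: (IH (i |: I)%SET) => //; first exact: ad_tensorial.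
    rewrite -ltnS; apply: leq_trans cI; apply: proper_card.
    rewrite finset.setCU; apply/properP; split; first exact: finset.subsetIr.
    by exists i; rewrite ?inE ?eqxx.
  move=> j; rewrite in_setU1 => /predU1P[->|jI]; first exact: ad_square.
  by rewrite ad_anti// kI// (ad0 hG) oppr0.
Qed.

(** After [k.+1] commutators with functions [A] is tensorial and [ads L] kills it; these commutators
    can be taken after [ads L] instead. *)
Lemma ads_order k A L : order_le k.+1 A -> size L = (vrank E).+1 ->
  order_le k (ads L A).
Proof.
move=> oA sL; elim: k A oA => [|k IH] A oA f; rewrite -ads_comm.
  by apply: ads_tensorial => //; apply/tensorialP; exact: oA.
by apply: IH; exact: oA.
Qed.

Lemma ads_order_vanish k A L : order_le k A -> size L = (k.+1 * (vrank E).+1)%N ->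
  ads L A = 0.
Proof.
elim: k A L => [|k IH] A L oA sL.
  by apply: ads_tensorial; [exact/tensorialP|rewrite sL mul1n].
have -> : ads L A = ads (drop (vrank E).+1 L) (ads (take (vrank E).+1 L) A).
  by rewrite -{1}(cat_take_drop (vrank E).+1 L) /ads foldl_cat.
apply: IH; last by rewrite size_drop sL mulSn addKn.
by apply: ads_order => //; rewrite size_takel// sL mulSn leq_addr.
Qed.

Lemma filt_exhaustive A : exists k, dfilt k A.
Proof.
(* Each of [k.+1] blocks of [(vrank E).+1] supercommutators lowers the order, the last one giving
   zero. The predecessor appears because weight [n] means that [n.+1] of them vanish. *)
have [k oA] := dop_order A; exists (k.+1 * (vrank E).+1).-1.
by apply: filt_ads => L sL; apply: (ads_order_vanish oA); rewrite sL.
Qed.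

(** * Operators of weight at most one, and their supercommutators *)

Hypothesis rank_gt0 : (0 < vrank E)%N.

Lemma metricZ x (a : R) (u w : E x) : g x (a *: u) w = a * g x u w.
Proof.
have g0 : g x 0 w = 0.
  by apply: (addrI (g x 0 w)); have := metric_linear g 1 0 0 w;
    rewrite scale1r addr0 mul1r addr0 => <-.
by rewrite -[a *: u]addr0 metric_linear g0 addr0.
Qed.

Lemma metric_nonzero x : exists xi eta, metric_section g xi eta x != 0.
Proof.
have [a ax] := tdom_cover E x; pose u : E x := frame a (Ordinal rank_gt0) x.
have u0 : u != 0.
  apply/eqP => u0; have := tmap_frame (Ordinal rank_gt0) ax.
  rewrite -/u u0 linear0 => /matrixP /(_ ord0 (Ordinal rank_gt0)) /eqP.
  by rewrite !mxE !eqxx eq_sym oner_eq0.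
have [w guw] : exists w, g x u w != 0.
  apply: contrapT => nw; move: u0; rewrite (_ : u = 0) ?eqxx//.
  apply: (metric_nondegenerate (f := g)) => w.
  by apply/eqP/negPn/negP => guw; apply: nw; exists w.
have [xi xix] := section_extend u; have [eta etax] := section_extend w.
by exists xi, eta; rewrite /= xix etax.
Qed.

Lemma filt1_tensorial A : dfilt 1 A -> tensorial A.
Proof.
move=> fA.
have metric_comm xi eta :
    dop_comm A (smoothf_of_real (metric_section g xi eta)) = 0.
  rewrite /dop_comm -gam_rel -(ad_anticomm hG); [|exact: gam_odd|exact: gam_odd].
  have ad2 a b : adg a (adg b A) = 0 by apply: (fA (gam b)); eexists.
  by rewrite !ad2 addr0.
have real_comm (f : C^oo(M)) : dop_comm A (smoothf_of_real f) = 0.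
  apply: dop_eq => s; apply: section_eq => x.
  have [xi [eta gx]] := metric_nonzero x.
  (* [A] commutes with [h] and with [F * h], the latter being the metric of [f *: xi] and [eta].
     Hence [h] times the commutator of [A] and [F] is zero, and [h] can be cancelled at [x]. *)
  pose h := smoothf_of_real (K := complex_scalars R) (metric_section g xi eta).
  pose F := smoothf_of_real (K := complex_scalars R) f.
  have hF : smoothf_of_real (metric_section g (f *: xi) eta) = F * h.
    apply: val_inj; apply/funext => y /=.
    rewrite -[LHS]/((g y (f y *: xi y) (eta y))%:C%C) metricZ.
    exact: (rmorphM (real_complex R)).
  have Ah : A * dop_scale S h = dop_scale S h * A.
    by apply: subr0_eq; exact: metric_comm.
  have AFh : A * dop_scale S F * dop_scale S h = dop_scale S F * A * dop_scale S h.
    rewrite -mulrA -dop_scaleM -hF (subr0_eq (metric_comm (f *: xi) eta)) hF.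
    by rewrite dop_scaleM -mulrA -Ah mulrA.
  have : (dop_scale S h * dop_comm A F) s x = 0.
    suff -> : dop_scale S h * dop_comm A F = 0 by [].
    rewrite /dop_comm mulrBr !mulrA -Ah -(mulrA A) (dop_scaleC S h F) mulrA AFh.
    by rewrite -!mulrA Ah subrr.
  rewrite dopM -[LHS]/((metric_section g xi eta x)%:C%C *: dop_comm A F s x) => /eqP.
  by rewrite scaler_eq0 fmorph_eq0 (negbTE gx) => /eqP.
move=> f.
have re_smooth : smooth setT ((fun y => complex.Re (f y)) : M -> real_scalars R).
  by split; [exact: (smoothfP f).1|exact: smooth_on_cst].
have im_smooth : smooth setT ((fun y => complex.Im (f y)) : M -> real_scalars R).
  by split; [exact: (smoothfP f).2|exact: smooth_on_cst].
(* Real and imaginary parts are covered by [real_comm], and the constant ['i] by complex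
   linearity. *)
have -> : f = smoothf_of_real (mk_smoothf re_smooth) +
    smoothf_cst M ('i%C : complex_scalars R) * smoothf_of_real (mk_smoothf im_smooth).
  apply: val_inj; apply/funext => y.
  rewrite -[RHS]/((complex.Re (f y))%:C%C + 'i%C * (complex.Im (f y))%:C%C).
  by rewrite [LHS]complexE.
rewrite dop_scaleD dop_scaleM mulrDr mulrDl !mulrA.
rewrite (subr0_eq (real_comm _)); congr (_ + _).
rewrite -[in RHS]mulrA -(subr0_eq (real_comm _)) mulrA; congr (_ * _).
by apply: dop_eq => s; exact: dop_cst.
Qed.

Lemma tensorial_local_comm x A B (hA hB : 'End(S x)) :
    (forall s, A s x = hA (s x)) -> (forall s, B s x = hB (s x)) ->
    (hA \o hB = hB \o hA)%VF ->
  forall s, (A * B) s x = (B * A) s x.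
Proof.
move=> AE BE hAB s; rewrite !dopM AE !BE AE.
by have := congr1 (fun h : 'End(S x) => h (s x)) hAB; rewrite !comp_lfunE.
Qed.

Lemma filt0_even A : dfilt 0 A -> dop_part false A.
Proof.
move=> fA; rewrite [A](part_sum hG).
suff -> : dpart true A = 0 by rewrite addr0; exact: (partG hG).
(* The odd part is shown to be even as well, as an even Clifford section; directness of the grading
   then makes it zero. *)
apply: (graded_direct hG); last exact: (partG hG).
have f1 : dfilt 0 (dpart true A) by exact: (filt_part hG gens_odd).
have G1 : dop_part true (dpart true A) by exact: (partG hG).
move: (dpart true A) f1 G1 => {fA}A fA GA.
have tA := filt1_tensorial (filtW hG fA).
have Aanti xi : gam xi * A = - (A * gam xi).
  apply/eqP; rewrite -addr_eq0 addrC; apply/eqP.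
  have := fA (gam xi) (ex_intro2 _ _ xi I erefl).
  by rewrite /ad (parity_odd hG GA) mulrN opprK.
apply: (grading_clifford hP).
suff aex : forall x, exists a : clifford (g x),
    clifford_part false a /\ forall s, A s x = iso a (s x).
  exists (fun x => projT1 (cid (aex x))).
  by split=> [x|s x]; case: (cid (aex x)) => a [pa aP] /=.
move=> x; have [h hE] := tensorial_fibre x tA.
  have [iinv isoK Kiso] := spinor_iso_bij S x.
  exists (iinv h); split; last by move=> s; rewrite Kiso.
  apply: gen_anticomm_even => [y yxy|v].
    apply: (can_inj isoK); rewrite iso0; apply: lfun_prime => f.
    by rewrite -(Kiso f) -!spinor_iso_mul yxy iso0.
  apply: (can_inj isoK); apply/lfunP => w.
  have [s sx] := section_extend w; have [xi xix] := section_extend v.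
  rewrite isoM Kiso -sx -hE -xix -gamE -dopM Aanti.
  rewrite -scaleN1r isoZ scale_lfunE isoM Kiso -gamE -hE.
  by rewrite scaleN1r.
Qed.

(** As [A] is even, weight 0 means ordinary commutation with all [gam xi]. In each fibre [A] then
    corresponds to a central Clifford element, while [B] corresponds to some Clifford element. *)
Lemma filt0_comm A B : dfilt 0 A -> dfilt 1 B -> A * B = B * A.
Proof.
move=> fA fB; have tB := filt1_tensorial fB.
have tA := filt1_tensorial (filtW hG fA).
have Acomm xi : gam xi * A = A * gam xi.
  apply/esym/subr0_eq; have := fA (gam xi) (ex_intro2 _ _ xi I erefl).
  by rewrite /ad (parity_even hG (filt0_even fA)).
apply: dop_eq => s; apply: section_eq => x.
have [hA hAE] := tensorial_fibre x tA; have [hB hBE] := tensorial_fibre x tB.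
apply: (tensorial_local_comm hAE hBE).
have [iinv isoK Kiso] := spinor_iso_bij S x.
rewrite -(Kiso hA) -(Kiso hB) -!spinor_iso_mul; congr iso.
apply/esym; apply: gen_comm_central => v.
apply: (can_inj isoK); apply/lfunP => w.
have [t tx] := section_extend w; have [xi xix] := section_extend v.
by rewrite !isoM Kiso -tx -xix -gamE -!hAE -gamE -!dopM Acomm.
Qed.

(** One factor has weight 0, hence is even, and the other has weight at most 1; so the
    supercommutator reduces to ordinary commutators. *)
Lemma dop_supercomm_base k l A B : (k + l <= 1)%N -> dfilt k A -> dfilt l B ->
  dsupercomm A B = 0.
Proof.
have part_comm A' B' i : dfilt 0 A' -> dfilt 1 B' -> A' * dpart i B' = dpart i B' * A'.
  by move=> fA fB; exact: filt0_comm fA (filt_part hG gens_odd i fB).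
have filtA0 A' : dfilt 0 A' -> dparity A' = A'.
  by move=> /filt0_even GA; exact: (parity_even hG GA).
move=> kl fA fB.
have [|] : (dfilt 0 A /\ dfilt 1 B) \/ (dfilt 1 A /\ dfilt 0 B).
- case: k l kl fA fB => [|[|k]] [|[|l]] // _ fA fB.
  + by left; split; [exact: fA|exact: (filtW hG fB)].
  + by left.
  + by right.
- move=> [{}fA {}fB]; rewrite (part_sum hG B) (supercommDr hG).
  rewrite (supercomm_sign hG A (partG hG false B)).
  rewrite (supercomm_sign hG A (partG hG true B)) /= (filtA0 _ fA).
  by rewrite !part_comm// !subrr addr0.
- move=> [{}fA {}fB]; rewrite (supercomm_sign hG A (filt0_even fB)) /=.
  by rewrite (filt0_comm fB fA) subrr.
Qed.

Lemma spin_filtration_supercomm k l A B : dfilt k A -> dfilt l B ->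
  spin_filtration P (k%:Z + l%:Z - 2) (val (dsupercomm A B)).
Proof.
move=> fA fB; have := filt_supercomm hG gens_odd dop_supercomm_base fA fB.
(* For totals 0 and 1 the target degree is negative, where [spin_filtration] is zero. *)
rewrite -PoszD; case: (k + l)%N => [->|[->|n fn]] //.
have -> : n.+2%:Z - 2 = n%:Z by rewrite -addn2 PoszD addrK.
by apply/spin_filtration_val.
Qed.

End SpinorFiltration.

Theorem proposition3p7 (R : realType) (M : manifold R) (E : real_bundle M)
    (g : fibre_metric E) (S : spinor_bundle g)
    (P : bool -> set (Gamma(S) -> Gamma(S))) :
  (0 < vrank E)%N -> ~~ odd (vrank E) -> spinor_grading P ->
  [/\ forall k : nat, complex_subspace (spin_filtration P k%:Z),
      forall k : nat,
        spin_filtration P k%:Z `<=` spin_filtration P k.+1%:Z,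
      diffop S = \bigcup_k spin_filtration P k%:Z,
      forall (k l : nat) (A B : Gamma(S) -> Gamma(S)),
        spin_filtration P k%:Z A -> spin_filtration P l%:Z B ->
        spin_filtration P (k + l)%N%:Z (A \o B) &
      forall (k l : nat) (A B : Gamma(S) -> Gamma(S)),
        spin_filtration P k%:Z A -> spin_filtration P l%:Z B ->
        spin_filtration P (k%:Z + l%:Z - 2) (gcomm P A B)].
Proof.
move=> rank_gt0 _ hP; have hG := dop_graded hP; have hodd := gens_odd (hP := hP).
split.
- move=> k; split.
  + by apply/(spin_filtration_val hP k 0); exact: (filt0 hG).
  + move=> _ _ /(spin_filtration_ex hP)[A -> fA] /(spin_filtration_ex hP)[B -> fB].
    by apply/(spin_filtration_val hP k (A + B)); exact: (filtD hG).
  + move=> c _ /(spin_filtration_ex hP)[A -> fA].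
    apply/(spin_filtration_val hP k (dop_scale S (smoothf_cst M (c : complex_scalars R)) * A)).
    (* Scaling by [c] is multiplication by a constant function, an operator of weight 0. *)
    by apply: (filtM hG hodd (k := 0)) => //; exact: filt_scale.
- move=> k _ /(spin_filtration_ex hP)[A -> fA].
  by apply/(spin_filtration_val hP k.+1 A); exact: (filtW hG).
- apply/seteqP; split=> [D dD|D [k _ /spin_filtration_diffop//]].
  have [k fk] := filt_exhaustive hP (mk_dop dD).
  by exists k => //; apply/(spin_filtration_val hP k (mk_dop dD)).
- move=> k l _ _ /(spin_filtration_ex hP)[A -> fA] /(spin_filtration_ex hP)[B -> fB].
  by apply/(spin_filtration_val hP (k + l) (A * B)); exact: (filtM hG hodd).
- move=> k l _ _ /(spin_filtration_ex hP)[A -> fA] /(spin_filtration_ex hP)[B -> fB].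
  rewrite (gcomm_val hP); exact: spin_filtration_supercomm.
Qed.
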